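(* Let $\mathcal{S}^{n-1}_n\subset\mathcal{C}^{\binom{n+1}{2}}$ be the variety of singular symmetric $n\times n$ matrices. Let $(u,v)$ be an edge of the Newton polytope of the symmetric $n\times n$ determinant, between two vertices given by (monomials of) permutations $u$ and $v$. The normal cone of this edge lies in $\mathrm{trop}_{\mathcal{C}^+}(\mathcal{S}^{n-1}_n)$ if and only if one of the following holds: 1. the edge has lattice length $1$, and $u$ and $v$ have opposite sign; 2. the edge has lattice length $2$, and the unique even cycle of length $\ge 4$ of its midpoint monomial has length divisible by $4$. In other words, $\mathrm{trop}_{\mathcal{C}^+}(\mathcal{S}^{n-1}_n)$ is the union of the normal cones to those edges of the Newton polytope that contain a positive and a negative monomial, or equivalently a positive and a negative permutation.
   Context: Let $\mathcal{C}=\mathbb{C}\{\!\{t\}\!\}$ be the field of complex Puiseux series with valuation $\mathrm{val}(a)$ = the exponent of the lowest degree term of $a\neq0$, and $\mathcal{C}^+\subset\mathcal{C}$ the subset of nonzero series whose leading coefficient is a positive real number. For a variety $X\subset\mathcal{C}^N$, $\mathrm{trop}_{\mathcal{C}^+}(X)=\overline{\{\mathrm{val}(x): x\in X\cap(\mathcal{C}^+)^N\}}\subset\mathbb{R}^N$ (coordinatewise valuation, Euclidean closure). The symmetric $n\times n$ determinant is the determinant of a symmetric matrix of indeterminates $(m_{ij})$, $m_{ij}=m_{ji}$, a polynomial in the $\binom{n+1}{2}$ variables $m_{ij}$, $i\le j$. Its monomials correspond to permutations in $S_n$ up to reversing the orientation of cycles; the sign of a monomial is the sign of any permutation giving that monomial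 (this is also the sign of its coefficient). The cycles of a monomial are the (unoriented) cycles of such a permutation. The Newton polytope is the convex hull in $\mathbb{R}^{\binom{n+1}{2}}$ of the exponent vectors of the monomials; its vertices correspond to permutations without even cycles of length at least $4$, up to reorientation of cycles. The lattice length of an edge is one less than the number of points of $\mathbb{Z}^{\binom{n+1}{2}}$ in the edge; an edge of lattice length $2$ has as its midpoint the exponent vector of a monomial of the symmetric determinant that is obtained from $u$ (and from $v$) by replacing $k\ge2$ transpositions with a single $2k$-cycle, which is the unique even cycle of length $\ge4$ of the midpoint monomial. The (inner) normal cone of an edge (or face) $F$ of a polytope $P$ is $\{w: w\cdot x\le w\cdot y\ \text{for all } x\in F,\ y\in P\}$. *)

(* Defs.v *)
From HB Require Import structures.
From mathcomp Require Import all_boot all_order all_algebra all_fingroup.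
From mathcomp Require Import all_classical all_reals all_analysis.
From mathcomp Require Import complex ring zify.
From mathcomp Require Import -(notations) mpoly.

Set Implicit Arguments.
Unset Strict Implicit.
Unset Printing Implicit Defensive.

Import Order.TTheory GRing.Theory Num.Theory.
Import numFieldNormedType.Exports.
Local Open Scope classical_set_scope.
Local Open Scope ring_scope.

Section Puiseux.
Variable K : fieldType.
Implicit Types (N i j m M : nat) (k l : int) (q r : rat).

Definition grid N k m : rat := (k%:~R + m%:R) / N%:R.

Definition on_grid N k (f : rat -> K) :=
  forall q, f q != 0 -> exists m, q = grid N k m.

(* The support of f lies in (1/N)Z and is bounded below by k/N. *)
Definition is_puiseux (f : rat -> K) :=
  exists N k, (0 < N)%N /\ on_grid N k f.

(* The series \sum_q (f q) t^q is represented by its coefficients. *)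
Record puiseux := Puiseux { pcoef :> rat -> K; pcoefP : is_puiseux pcoef }.

HB.instance Definition _ := gen_eqMixin puiseux.
HB.instance Definition _ := gen_choiceMixin puiseux.

Lemma puiseux_ext (f g : puiseux) : (forall q, f q = g q) -> f = g.
Proof.
case: f g => [f fP] [g gP] /= /funext efg; move: gP; rewrite -efg => gP.
by congr Puiseux; exact: Prop_irrelevance.
Qed.

Lemma gridD N k i m : grid N (k + Posz i) m = grid N k (i + m).
Proof. by rewrite /grid intrD natrD addrA. Qed.

Lemma grid_inj N k : (0 < N)%N -> injective (grid N k).
Proof.
move=> N0 i j /(mulIf _) e; have /e : N%:R^-1 != 0 :> rat.
  by rewrite invr_eq0 pnatr_eq0 -lt0n.
by move=> /addrI /eqP; rewrite eqr_nat => /eqP.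
Qed.

Lemma on_gridW N k l f : (l <= k)%R -> on_grid N k f -> on_grid N l f.
Proof.
move=> lk fP q /fP[m ->]; exists (absz (k - l) + m)%N.
by rewrite -gridD gez0_abs ?subr_ge0// addrCA subrr addr0.
Qed.

Lemma on_gridM N d k f : (0 < N)%N -> (0 < d)%N ->
  on_grid N k f -> on_grid (N * d) (k * Posz d) f.
Proof.
move=> N0 d0 fP q /fP[m ->]; exists (m * d)%N.
have ? : N%:R != 0 :> rat by rewrite pnatr_eq0 -lt0n.
have ? : d%:R != 0 :> rat by rewrite pnatr_eq0 -lt0n.
rewrite /grid intrM !natrM -pmulrn -mulrDl; field.
by apply/andP.
Qed.

Lemma common_grid2 (f g : puiseux) :
  exists N k, [/\ (0 < N)%N, on_grid N k f & on_grid N k g].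
Proof.
have [N [k [N0 fP]]] := pcoefP f; have [M [l [M0 gP]]] := pcoefP g.
exists (N * M)%N, (Order.min (k * Posz M) (l * Posz N)); split.
- by rewrite muln_gt0 N0.
- by apply: on_gridW (on_gridM N0 M0 fP); rewrite ge_min lexx.
- by rewrite mulnC; apply: on_gridW (on_gridM M0 N0 gP); rewrite ge_min lexx orbT.
Qed.

Lemma common_grid3 (f g h : puiseux) : exists N k,
  [/\ (0 < N)%N, on_grid N k f, on_grid N k g & on_grid N k h].
Proof.
have [N [k [N0 fP gP]]] := common_grid2 f g.
have [M [l [M0 hP]]] := pcoefP h.
exists (N * M)%N, (Order.min (k * Posz M) (l * Posz N)); split.
- by rewrite muln_gt0 N0.
- by apply: on_gridW (on_gridM N0 M0 fP); rewrite ge_min lexx.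
- by apply: on_gridW (on_gridM N0 M0 gP); rewrite ge_min lexx.
- by rewrite mulnC; apply: on_gridW (on_gridM M0 N0 hP); rewrite ge_min lexx orbT.
Qed.

Lemma on_grid_ext N k (f g : puiseux) : on_grid N k f -> on_grid N k g ->
  (forall m, f (grid N k m) = g (grid N k m)) -> f = g.
Proof.
move=> fP gP efg; apply: puiseux_ext => q.
have [fq|/fP[m ->]//] := eqVneq (f q) 0.
by have [gq|/gP[m ->]//] := eqVneq (g q) 0; rewrite fq.
Qed.

Lemma grid1 N : (0 < N)%N -> on_grid N 0 (fun q => (q == 0)%:R).
Proof.
move=> N0 q; have [-> _|] := eqVneq q 0; last by rewrite eqxx.
by exists 0%N; rewrite /grid addr0 mul0r.
Qed.

Lemma zero_subproof : is_puiseux (fun=> 0).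
Proof. by exists 1%N, 0; split=> // q; rewrite eqxx. Qed.

Lemma opp_subproof (f : puiseux) : is_puiseux (fun q => - f q).
Proof.
have [N [k [N0 fP]]] := pcoefP f.
by exists N, k; split=> // q; rewrite oppr_eq0 => /fP.
Qed.

Lemma on_gridD N k (f g : rat -> K) : on_grid N k f -> on_grid N k g ->
  on_grid N k (fun q => f q + g q).
Proof.
move=> fP gP q; have [->|/fP//] := eqVneq (f q) 0.
by rewrite add0r => /gP.
Qed.

Lemma add_subproof (f g : puiseux) : is_puiseux (fun q => f q + g q).
Proof.
have [N [k [N0 fP gP]]] := common_grid2 f g.
by exists N, k; split=> //; exact: on_gridD.
Qed.

Lemma one_subproof : is_puiseux (fun q => (q == 0)%:R).
Proof. by exists 1%N, 0; split=> //; exact: grid1. Qed.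

(* The sum has only finitely many nonzero terms. *)
Definition pconv (f g : rat -> K) q := \sum_(a \in [set: rat]) f a * g (q - a).

Lemma on_grid_conv N k l f g : (0 < N)%N -> on_grid N k f -> on_grid N l g ->
  on_grid N (k + l) (pconv f g).
Proof.
move=> N0 fP gP q fgq.
have [a fga] : exists a, f a * g (q - a) != 0.
  apply: contrapT => /forallNP h; move/eqP: fgq; apply.
  by apply: fsbig1 => a _; apply/eqP/negPn/negP/h.
move: fga; rewrite mulf_eq0 negb_or => /andP[/fP[i ->] /gP[j qij]].
exists (i + j)%N; rewrite -(subrK (grid N k i) q) qij.
by rewrite /grid intrD natrD; field; rewrite pnatr_eq0 -lt0n.
Qed.

Lemma pconv_subproof (f g : puiseux) : is_puiseux (pconv f g).
Proof.
have [N [k [N0 fP gP]]] := common_grid2 f g.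
by exists N, (k + k); split=> //; exact: on_grid_conv.
Qed.

Definition trunc N k M (f : rat -> K) : {poly K} := \poly_(i < M) f (grid N k i).

Lemma conv_grid N k l f g m : (0 < N)%N -> on_grid N k f -> on_grid N l g ->
  pconv f g (grid N (k + l) m) =
  \sum_(i < m.+1) f (grid N k i) * g (grid N l (m - i)).
Proof.
move=> N0 fP gP.
have gB i : (i <= m)%N -> grid N (k + l) m - grid N k i = grid N l (m - i).
  move=> im; rewrite /grid intrD natrB//.
  by field; rewrite pnatr_eq0 -lt0n.
rewrite /pconv (fsbigE [seq grid N k i | i <- iota 0 m.+1]).
- rewrite big_map (big_nth 0%N) size_iota big_mkord.
  rewrite [LHS](eq_bigl xpredT); last by move=> i; rewrite mem_set.
  by apply: eq_bigr => -[i im] _; rewrite nth_iota// add0n gB.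
- by rewrite map_inj_uniq ?iota_uniq//; exact: grid_inj.
- by [].
move=> a _; apply: contraNeq; rewrite mulf_eq0 negb_or => /andP[/fP[i ->] /gP[j e]].
rewrite map_f// mem_iota add0n/= ltnS.
have : grid N (k + l) m = grid N (k + l) (i + j).
  rewrite -[LHS](subrK (grid N k i)) e.
  by rewrite /grid intrD natrD; field; rewrite pnatr_eq0 -lt0n.
by move/(grid_inj N0) ->; exact: leq_addr.
Qed.

Lemma conv_trunc N k l f g m M : (0 < N)%N -> (m < M)%N ->
  on_grid N k f -> on_grid N l g ->
  pconv f g (grid N (k + l) m) = (trunc N k M f * trunc N l M g)`_m.
Proof.
move=> N0 mM fP gP; rewrite conv_grid// coefM; apply: eq_bigr => -[i /= im] _.
by rewrite !coef_poly !ifT//; lia.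
Qed.

Definition pzero := Puiseux zero_subproof.
Definition pone := Puiseux one_subproof.
Definition popp f := Puiseux (opp_subproof f).
Definition padd f g := Puiseux (add_subproof f g).
Definition pmul f g := Puiseux (pconv_subproof f g).

Lemma paddA : associative padd.
Proof. by move=> f g h; apply: puiseux_ext => q /=; rewrite addrA. Qed.
Lemma paddC : commutative padd.
Proof. by move=> f g; apply: puiseux_ext => q /=; rewrite addrC. Qed.
Lemma padd0 : left_id pzero padd.
Proof. by move=> f; apply: puiseux_ext => q /=; rewrite add0r. Qed.
Lemma paddN : left_inverse pzero popp padd.
Proof. by move=> f; apply: puiseux_ext => q /=; rewrite addNr. Qed.

HB.instance Definition _ := GRing.isZmodule.Build puiseux paddA paddC padd0 paddN.

Lemma coefM_eq (p p' q q' : {poly K}) m :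
  (forall i, (i <= m)%N -> p`_i = p'`_i) ->
  (forall i, (i <= m)%N -> q`_i = q'`_i) -> (p * q)`_m = (p' * q')`_m.
Proof.
move=> pE qE; rewrite !coefM; apply: eq_bigr => -[i /= im] _.
by rewrite pE ?qE// leq_subr.
Qed.

Lemma trunc_conv N k l f g m M : (0 < N)%N -> (m < M)%N ->
  on_grid N k f -> on_grid N l g ->
  (trunc N (k + l) M (pconv f g))`_m = (trunc N k M f * trunc N l M g)`_m.
Proof. by move=> N0 mM fP gP; rewrite coef_poly mM; exact: conv_trunc. Qed.

Lemma pmulA : associative pmul.
Proof.
move=> f g h; have [N [k [N0 fP gP hP]]] := common_grid3 f g h.
have fgP := on_grid_conv N0 fP gP; have ghP := on_grid_conv N0 gP hP.
apply: (@on_grid_ext N (k + (k + k))).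
- exact: on_grid_conv.
- by rewrite addrA; exact: on_grid_conv.
move=> m /=; rewrite (@conv_trunc _ _ _ _ _ _ m.+1)// addrA.
rewrite (@conv_trunc _ _ _ _ _ _ m.+1)//.
transitivity (trunc N k m.+1 f * (trunc N k m.+1 g * trunc N k m.+1 h))`_m.
  by apply: coefM_eq => // i im; rewrite trunc_conv.
by rewrite mulrA; apply: coefM_eq => // i im; rewrite trunc_conv.
Qed.

Lemma pmulC : commutative pmul.
Proof.
move=> f g; have [N [k [N0 fP gP]]] := common_grid2 f g.
apply: (@on_grid_ext N (k + k)); try exact: on_grid_conv.
by move=> m /=; rewrite !(@conv_trunc _ _ _ _ _ _ m.+1)// mulrC.
Qed.

Lemma pmul1 : left_id pone pmul.
Proof.
move=> f; have [N [k [N0 fP]]] := pcoefP f.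
apply: (@on_grid_ext N (0 + k)); rewrite ?add0r//.
  by rewrite -[k]add0r; apply: on_grid_conv => //; exact: grid1.
move=> m /=; rewrite -[k in LHS]add0r conv_grid//; last exact: grid1.
rewrite big_ord_recl /= subn0 {1}/grid addr0 mul0r eqxx mul1r.
rewrite big1 ?addr0// => i _.
by rewrite /grid add0r mulf_eq0 invr_eq0 !pnatr_eq0/= gtn_eqF// mul0r.
Qed.

Lemma pmulD : left_distributive pmul padd.
Proof.
move=> f g h; have [N [k [N0 fP gP hP]]] := common_grid3 f g h.
apply: (@on_grid_ext N (k + k)).
- by apply: on_grid_conv => //; exact: on_gridD.
- by apply: on_gridD; exact: on_grid_conv.
move=> m /=; rewrite !conv_grid//; last exact: on_gridD.
by rewrite -big_split; apply: eq_bigr => i _ /=; rewrite mulrDl.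
Qed.

Lemma pone_neq0 : pone != pzero.
Proof.
apply/eqP => /(congr1 (fun f => pcoef f 0)) /= /eqP.
by rewrite oner_eq0.
Qed.

HB.instance Definition _ :=
  GRing.Zmodule_isComNzRing.Build puiseux pmulA pmulC pmul1 pmulD pone_neq0.

Lemma puiseux_neq0 (f : puiseux) : f != 0 -> exists q, f q != 0.
Proof.
move=> /eqP f0; apply: contrapT => /forallNP h; apply: f0.
by apply: puiseux_ext => q; apply/eqP/negPn/negP/h.
Qed.

Lemma first_term (f : puiseux) : f != 0 ->
  exists N k, [/\ (0 < N)%N, on_grid N k f & f (grid N k 0) != 0].
Proof.
move=> /puiseux_neq0[q fq]; have [N [k [N0 fP]]] := pcoefP f.
have exm : exists m, f (grid N k m) != 0 by have [m mq] := fP _ fq; exists m; rewrite -mq.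
have [m fm mmin] := ex_minnP exm; exists N, (k + Posz m).
split; rewrite ?gridD ?addn0// => r fr.
have [j rj] := fP _ fr; exists (j - m)%N.
by rewrite gridD subnKC// mmin// -rj.
Qed.

Lemma pval_exists (f : puiseux) : f != 0 ->
  exists q, f q != 0 /\ forall r, f r != 0 -> q <= r.
Proof.
move=> /first_term[N [k [N0 fP fk]]]; exists (grid N k 0); split=> // r /fP[m ->].
by rewrite /grid ler_pM2r ?invr_gt0 ?ltr0n// lerD2l ler0n.
Qed.

(* The coefficients of the inverse of the power series with coefficients a. *)
Fixpoint inv_seq (a : nat -> K) n : seq K :=
  if n is n'.+1 then
    let s := inv_seq a n' in
    rcons s (((n' == 0)%N%:R - \sum_(i < n') a (n' - i)%N * s`_i) / a 0%N)
  else [::].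

Definition inv_coef a n := (inv_seq a n.+1)`_n.

Lemma size_inv_seq a n : size (inv_seq a n) = n.
Proof. by elim: n => //= n IH; rewrite size_rcons IH. Qed.

Lemma nth_inv_seq a n i : (i < n)%N -> (inv_seq a n)`_i = inv_coef a i.
Proof.
elim: n => // n IH; rewrite ltnS leq_eqVlt => /orP[/eqP->//|i_n].
by rewrite /= nth_rcons size_inv_seq i_n IH.
Qed.

Lemma inv_coefP a n : a 0%N != 0 ->
  \sum_(i < n.+1) a (n - i)%N * inv_coef a i = (n == 0)%N%:R.
Proof.
move=> a0; rewrite big_ord_recr/= subnn [inv_coef a n]/inv_coef/=.
rewrite nth_rcons size_inv_seq ltnn eqxx mulrC divfK//.
under eq_bigr => i _ do rewrite -(@nth_inv_seq a n)//.
by rewrite addrC subrK.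
Qed.

Lemma pinv_exists (f : puiseux) : f != 0 -> exists g, pmul g f = pone.
Proof.
move=> /first_term[N [k [N0 fP fk]]].
pose b := inv_coef (fun m => f (grid N k m)).
pose z q : rat := q * N%:R + k%:~R.
pose g q := if z q \is a Num.nat then b (Num.truncn (z q)) else 0.
have Nn0 : N%:R != 0 :> rat by rewrite pnatr_eq0 -lt0n.
have zg m : z (grid N (- k) m) = m%:R by rewrite /z /grid intrN; field.
have gg m : g (grid N (- k) m) = b m by rewrite /g zg natr_nat natrK.
have gP : on_grid N (- k) g.
  move=> q; rewrite /g; case: ifP; last by rewrite eqxx.
  move=> /natrP[m zq] _; exists m; rewrite /grid -zq intrN /z; field.
  exact: Nn0.
have gP' : is_puiseux g by exists N, (- k).
exists (Puiseux gP'); apply: (@on_grid_ext N (- k + k)).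
- exact: on_grid_conv.
- by rewrite addNr; exact: grid1.
move=> m /=; rewrite conv_grid//.
under eq_bigr => i _ do rewrite gg mulrC.
rewrite (@inv_coefP (fun m => f (grid N k m)))//.
by rewrite addNr /grid add0r mulf_eq0 invr_eq0 (negPf Nn0) orbF pnatr_eq0.
Qed.

Definition pinv (f : puiseux) : puiseux :=
  if f == 0 then 0 else xget 0 [set g | pmul g f = pone].

Lemma pmulV (f : puiseux) : f != 0 -> pinv f * f = 1.
Proof.
move=> f0; rewrite /pinv (negPf f0).
by case: xgetP => [g _ //|h]; have [g /h] := pinv_exists f0.
Qed.

Lemma pinv0 : pinv 0 = 0.
Proof. by rewrite /pinv eqxx. Qed.

HB.instance Definition _ := GRing.ComNzRing_isField.Build puiseux pmulV pinv0.

Definition pval (f : puiseux) : rat :=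
  xget 0 [set q | f q != 0 /\ forall r, f r != 0 -> q <= r].

Lemma pvalP (f : puiseux) : f != 0 ->
  f (pval f) != 0 /\ forall r, f r != 0 -> pval f <= r.
Proof.
by move=> /pval_exists[q fq]; rewrite /pval; case: xgetP => [//|/(_ q)].
Qed.

End Puiseux.

(* In the partial order of R[i], [0 < c] says that c is real and positive. *)
Definition Cplus (R : realType) : set (puiseux R[i]) :=
  [set f : puiseux R[i] | f != 0 /\ 0 < f (pval f)].

Definition val_point (R : realType) N (x : 'rV[puiseux R[i]]_N) : 'rV[R]_N :=
  \row_k ratr (pval (x 0 k)).

Definition trop_Cplus (R : realType) N (X : set 'rV[puiseux R[i]]_N) :
    set 'rV[R]_N :=
  closure [set val_point x | x in X `&` [set x | forall k, Cplus (x 0 k)]].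

Section Polyhedra.
Variables (R : realType) (N : nat).
Implicit Types (A P F : set 'rV[R]_N) (a b w x y : 'rV[R]_N).

Definition dot w x : R := \sum_k w 0 k * x 0 k.

Definition conv_hull A : set 'rV[R]_N := smallest (@convex_set R 'rV[R]_N) A.

Definition segment a b : set 'rV[R]_N :=
  [set (1 - t) *: a + t *: b | t in [set t : R | 0 <= t <= 1]].

Definition face P w : set 'rV[R]_N :=
  [set x | P x /\ forall y, P y -> dot w x <= dot w y].

Definition is_edge P a b :=
  a != b /\ exists w, face P w = segment a b.

Definition normal_cone P F : set 'rV[R]_N :=
  [set w | forall x y, F x -> P y -> dot w x <= dot w y].

Definition lattice : set 'rV[R]_N :=
  [set x | forall k, x 0 k \is a Num.int].

Definition has_lattice_length F (l : nat) :=
  (F `&` lattice #= `I_l.+1)%card.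

Definition exponent_vector (m : multinom N) : 'rV[R]_N := \row_k (m k)%:R.

Definition newton_polytope (p : mpoly N int) : set 'rV[R]_N :=
  conv_hull [set exponent_vector m | m in [set` msupp p]].

End Polyhedra.

Section SymmetricMatrices.
Variable n : nat.
Implicit Types s : 'S_n.

Definition upper_index := {ij : 'I_n * 'I_n | (ij.1 <= ij.2)%N}.

Definition symdim := #|{: upper_index}|.

Lemma symdimE : symdim = 'C(n.+1, 2).
Proof.
rewrite /symdim card_sig -sum1_card big_mkcond /=.
rewrite -(pair_big xpredT xpredT (fun i j : 'I_n => (i <= j)%N : nat)) /=.
rewrite exchange_big /= -bin2_sum big_mkord [RHS]big_ord_recl add0n.
apply: eq_bigr => j _; rewrite -big_mkcond /=.
by rewrite -(big_ord_widen n (fun=> 1%N) (ltn_ord j)) sum1_card card_ord.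
Qed.

Definition sort_pair (i j : 'I_n) : 'I_n * 'I_n :=
  if (i <= j)%N then (i, j) else (j, i).

Lemma sort_pairP i j : ((sort_pair i j).1 <= (sort_pair i j).2)%N.
Proof. by rewrite /sort_pair; have [//|/ltnW] := leqP i j. Qed.

(* The coordinate of m_ij = m_ji. *)
Definition symvar (i j : 'I_n) : 'I_symdim :=
  enum_rank (exist _ (sort_pair i j) (sort_pairP i j) : upper_index).

Definition sym_mx (T : Type) (x : 'rV[T]_symdim) : 'M[T]_n :=
  \matrix_(i, j) x 0 (symvar i j).

Definition symdet : mpoly symdim int :=
  \det (sym_mx (\row_k mpolyX int (mnm1 k))).

Definition perm_monomial s : multinom symdim :=
  \big[@mnm_add _ / @mnm0 _]_i mnm1 (symvar i (s i)).

Lemma symdetE : symdet =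
  \sum_(s : 'S_n) (-1) ^+ s * mpolyX int (perm_monomial s).
Proof.
apply: eq_bigr => s _; congr (_ * _).
under eq_bigr => i _ do rewrite !mxE.
rewrite /perm_monomial.
by elim/big_rec2: _ => [|i m p _ ->]; rewrite ?mpolyX0 ?mpolyXD.
Qed.

Definition long_even_cycles s : {set {set 'I_n}} :=
  [set c in porbits s | ~~ odd #|c| & (4 <= #|c|)%N]%SET.

End SymmetricMatrices.

Section SymmetricDeterminant.
Variables (R : realType) (n : nat).

Definition singular_symmetric : set 'rV[puiseux R[i]]_(symdim n) :=
  [set x | \det (sym_mx x) = 0].

Definition symdet_polytope : set 'rV[R]_(symdim n) :=
  newton_polytope (symdet n).

Definition perm_point (s : 'S_n) : 'rV[R]_(symdim n) :=
  exponent_vector R (perm_monomial s).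

Definition has_both_signs_monomial (E : set 'rV[R]_(symdim n)) :=
  exists m1 m2 : multinom (symdim n),
    [/\ E (exponent_vector R m1), E (exponent_vector R m2),
        0 < mcoeff m1 (symdet n) & mcoeff m2 (symdet n) < 0].

Definition has_both_signs_perm (E : set 'rV[R]_(symdim n)) :=
  exists s1 s2 : 'S_n,
    [/\ E (perm_point s1), E (perm_point s2), ~~ odd_perm s1 & odd_perm s2].

End SymmetricDeterminant.

Arguments singular_symmetric : clear implicits.
Arguments symdet_polytope : clear implicits.

(* Main.v *)
(* Call a weight w mixed if both an even and an odd permutation minimize w over
   the monomials of the symmetric determinant. The coefficient of lowest order of
   the determinant at a point with positive leading coefficients is a signed sum
   of positive terms over the minimizers, so the tropicalization consists of
   mixed weights.

   A long even cycle of a permutation s splits in two ways into transpositions,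
   giving s1 and s2 with s1 + s2 = 2 s for exponent vectors; the sign changes
   exactly when 4 divides the length. Hence a mixed w is minimized either by some
   s whose only long even cycle c has 4 | #|c|, or by two vertices of opposite
   signs. In the second case the initial form takes both signs on the positive
   orthant. In the first case the segment [s1, s2] is an edge, w is a limit of
   weights that are minimized only along this edge, and there the initial form
   is the determinant of the weighted graph of s, which vanishes when all
   weights are 1 because the graph contains a cycle of length divisible by 4. In
   both cases one coordinate carries a positive root of the initial form; the
   determinant is quadratic in each variable, so the quadratic formula lifts the
   root to complex Puiseux series, even when it is a double root.

   The edges are found in the first case as above and in the second case by a
   step of the simplex algorithm. Since exponents are at most 2, an edge [u, v]
   contains no lattice point besides its ends and possibly its midpoint. *)

Require Import Defs.
From HB Require Import structures.
From mathcomp Require Import all_boot all_order all_algebra all_fingroup.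
From mathcomp Require Import all_classical all_reals all_analysis.
From mathcomp Require Import complex.
From mathcomp Require Import ring lra zify.
From mathcomp Require Import -(notations) mpoly.

Import Order.TTheory GRing.Theory Num.Theory.
Import numFieldNormedType.Exports.
Local Open Scope classical_set_scope.
Local Open Scope ring_scope.

Set Implicit Arguments.
Unset Strict Implicit.
Unset Printing Implicit Defensive.

(** * Puiseux series and the quadratic formula *)

Local Notation pval := Defs.pval.

Section LeadingTerm.
Variable K : fieldType.
Implicit Types (f g : puiseux K) (q r : rat) (c d : K).

(* [f = c t^q + (terms of higher order)], where [c = 0] is allowed. *)
Definition lead f q c := (forall r, r < q -> f r = 0) /\ f q = c.

Lemma lead0 q : lead 0 q 0.
Proof. by []. Qed.

Lemma leadD f g q c d : lead f q c -> lead g q d -> lead (f + g) q (c + d).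
Proof.
move=> [f0 fq] [g0 gq]; split=> [r rq|]; last by rewrite /= fq gq.
by rewrite /= f0// g0// addr0.
Qed.

Lemma leadN f q c : lead f q c -> lead (- f) q (- c).
Proof.
by move=> [f0 fq]; split=> [r rq|] /=; rewrite ?fq// f0// oppr0.
Qed.

Lemma lead_weaken f q r c : q < r -> lead f r c -> lead f q 0.
Proof.
by move=> qr [f0 _]; split=> [s sq|]; apply: f0 => //; exact: lt_trans qr.
Qed.

Lemma pconv_single (f g : rat -> K) a q :
  (forall b, b != a -> f b * g (q - b) = 0) -> pconv f g q = f a * g (q - a).
Proof.
move=> h; transitivity (\sum_(b \in [set a]) f b * g (q - b)); last by rewrite fsbig_set1.
by apply/esym/fsbig_widen => // b [_ /= /eqP ba]; exact: h.
Qed.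

Lemma leadM f g q r c d :
  lead f q c -> lead g r d -> lead (f * g) (q + r) (c * d).
Proof.
move=> [f0 fq] [g0 gr]; split=> [s sqr|].
  have h b : f b * g (s - b) = 0.
    have [/f0->|qb] := ltP b q; first by rewrite mul0r.
    by rewrite g0 ?mulr0// ltrBlDl (lt_le_trans sqr)// lerD2r.
  by rewrite [LHS](pconv_single (a := 0)) ?h.
rewrite [LHS](pconv_single (a := q)) => [|b bq].
  by rewrite addrAC subrr add0r fq gr.
have [/f0->|qb] := ltP b q; first by rewrite mul0r.
by rewrite g0 ?mulr0// ltrBlDl ltrD2r lt_neqAle eq_sym bq.
Qed.

Lemma lead1 : lead 1 0 1.
Proof. by split=> [r r0|] /=; rewrite ?eqxx// lt_eqF. Qed.

Lemma lead_sum (I : Type) (s : seq I) (P : pred I) (F : I -> puiseux K) q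
    (c : I -> K) :
  (forall i, P i -> lead (F i) q (c i)) ->
  lead (\sum_(i <- s | P i) F i) q (\sum_(i <- s | P i) c i).
Proof.
move=> h; apply: (big_ind2 (fun f d => lead f q d)) => //.
by move=> *; exact: leadD.
Qed.

Lemma lead_prod (I : Type) (s : seq I) (P : pred I) (F : I -> puiseux K)
    (q : I -> rat) (c : I -> K) :
  (forall i, P i -> lead (F i) (q i) (c i)) ->
  lead (\prod_(i <- s | P i) F i) (\sum_(i <- s | P i) q i)
       (\prod_(i <- s | P i) c i).
Proof.
move=> h; apply: (big_ind3 (fun f r d => lead f r d)) => //; first exact: lead1.
by move=> *; exact: leadM.
Qed.

Lemma leadX f q c m : lead f q c -> lead (f ^+ m) (q *+ m) (c ^+ m).
Proof.
move=> h; elim: m => [|m IH]; first exact: lead1.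
by rewrite !exprS mulrS; exact: leadM.
Qed.

Lemma lead_pval f : f != 0 -> lead f (pval f) (f (pval f)).
Proof.
move=> /pvalP[_ fmin]; split=> // r; apply: contraTeq => /fmin.
by rewrite -leNgt.
Qed.

Lemma lead_neq0 f q c : c != 0 -> lead f q c -> f != 0.
Proof. by move=> c0 [_ fq]; apply: contraNneq c0 => f0; rewrite -fq f0. Qed.

Lemma pval_lead f q c : c != 0 -> lead f q c -> pval f = q.
Proof.
move=> c0 fqc; have [fv fmin] := pvalP (lead_neq0 c0 fqc).
case: fqc => f0 fq; apply/le_anti; rewrite fmin ?fq//=.
by rewrite leNgt; apply: contraNN fv => /f0 ->.
Qed.

(** The leading coefficient [c * d] of [f * f^-1 = 1] is a product of nonzero elements, which forces
    its exponent to be 0 and the product to be 1. *)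
Lemma leadV f q c : c != 0 -> lead f q c -> lead f^-1 (- q) c^-1.
Proof.
move=> c0 fqc; have f0 := lead_neq0 c0 fqc.
have V0 : f^-1 != 0 by rewrite invr_eq0.
have [d0 _] := pvalP V0; have := lead_pval V0.
move: (pval _) (f^-1 _) d0 => v d d0 fV.
have := leadM fqc fV; rewrite divff// => -[_ /= /esym h].
have qv : q + v = 0.
  by move: h; case: eqP => // _ /eqP; rewrite mulr0n mulf_eq0 (negPf c0) (negPf d0).
move: h; rewrite qv eqxx => h; rewrite -(addKr q v) qv addr0 in fV.
by rewrite -[c^-1]mulr1 -[1]/(true%:R) -h mulKf.
Qed.

Lemma series_exists N k (b : nat -> K) : (0 < N)%N ->
  exists f, on_grid N k f /\ forall m, f (grid N k m) = b m.
Proof.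
(* [z] inverts [grid N k], turning an exponent into its index. *)
move=> N0; pose z q : rat := q * N%:R - k%:~R.
pose g q := if z q \is a Num.nat then b (Num.truncn (z q)) else 0.
have Nn0 : N%:R != 0 :> rat by rewrite pnatr_eq0 -lt0n.
have zg m : z (grid N k m) = m%:R by rewrite /z /grid; field.
have gP : on_grid N k g.
  move=> q; rewrite /g; case: ifP; last by rewrite eqxx.
  move=> /natrP[m zq] _; exists m; rewrite /grid -zq /z; field.
  exact: Nn0.
have gP' : is_puiseux g by exists N, k.
by exists (Puiseux gP'); split=> // m; rewrite /= /g zg natr_nat natrK.
Qed.

Lemma monomial_exists q c : exists f, lead f q c.
Proof.
have N0 : (0 < `|denq q|)%N by rewrite absz_gt0 denq_neq0.
have gq : grid `|denq q| (numq q) 0 = q.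
  rewrite /grid addr0 -[RHS]divq_num_den; congr (_ / _).
  by rewrite pmulrn absz_denq.
have [f [fP fb]] := series_exists (numq q) (fun m => if m == 0%N then c else 0) N0.
exists f; split=> [r|]; last by rewrite -{1}gq fb.
apply: contraTeq => /fP[m ->]; rewrite -leNgt -[q in q <= _]gq.
by rewrite ler_pM2r ?invr_gt0 ?ltr0n// lerD2l ler0n.
Qed.

End LeadingTerm.

Section QuadraticLift.
Variable K : numClosedFieldType.
Implicit Types (f g : puiseux K) (q r : rat) (c d : K).

(* The coefficients of a square root of the power series with coefficients a. *)
Fixpoint sqrt_seq (a : nat -> K) n : seq K :=
  if n is n'.+1 then
    let s := sqrt_seq a n' in
    rcons s (if n' is m.+1 then
      (a n' - \sum_(i < m) s`_i.+1 * s`_(m - i)) / (s`_0 *+ 2)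
    else sqrtC (a 0%N))
  else [::].

Definition sqrt_coef a n := (sqrt_seq a n.+1)`_n.

Lemma size_sqrt_seq a n : size (sqrt_seq a n) = n.
Proof. by elim: n => //= n IH; rewrite size_rcons IH. Qed.

Lemma nth_sqrt_seq a n i : (i < n)%N -> (sqrt_seq a n)`_i = sqrt_coef a i.
Proof.
elim: n => // n IH; rewrite ltnS leq_eqVlt => /orP[/eqP->//|i_n].
by rewrite /= nth_rcons size_sqrt_seq i_n IH.
Qed.

Lemma sqrt_coefP a n : a 0%N != 0 ->
  \sum_(i < n.+1) sqrt_coef a i * sqrt_coef a (n - i) = a n.
Proof.
move=> a0; have s0 : sqrt_coef a 0 = sqrtC (a 0%N) by [].
case: n => [|n]; first by rewrite big_ord1 s0 -expr2 sqrtCK.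
rewrite big_ord_recl big_ord_recr /= subn0 subnn mulrC.
set S := \sum_(i < n) _.
have -> : sqrt_coef a n.+1 = (a n.+1 - S) / (sqrt_coef a 0 *+ 2).
  rewrite {1}/sqrt_coef; set s := sqrt_seq a n.+1.
  rewrite -[sqrt_seq a n.+2]/(rcons s ((a n.+1 -
    \sum_(i < n) s`_i.+1 * s`_(n - i)) / (s`_0 *+ 2))).
  rewrite nth_rcons size_sqrt_seq ltnn eqxx nth_sqrt_seq//; congr ((_ - _) / _).
  apply: eq_bigr => i _.
  by rewrite !nth_sqrt_seq ?ltnS ?leq_subr// ?lift0 1?ltn_ord// /bump.
have : sqrt_coef a 0 != 0 by rewrite s0 sqrtC_eq0.
by move: (sqrt_coef a 0) S => x S x0; field; rewrite x0 ?pnatr_eq0.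
Qed.

(** On the grid with doubled denominator the lowest exponent of [f] is twice a grid exponent, so a
    square root can start there. *)
Lemma puiseux_sqrt f : exists g, g * g = f.
Proof.
have [->|/first_term[N [k [N0 fP fk]]]] := eqVneq f 0; first by exists 0; rewrite mulr0.
have fP2 : on_grid (N * 2) (k + k) f.
  have -> : k + k = k * Posz 2 by lia.
  exact: on_gridM.
have N20 : (0 < N * 2)%N by rewrite muln_gt0 N0.
pose a m := f (grid (N * 2) (k + k) m).
have a0 : a 0%N != 0.
  rewrite /a; have <-// : grid N k 0 = grid (N * 2) (k + k) 0.
  by rewrite /grid !addr0 natrM intrD; field; rewrite pnatr_eq0 -lt0n.
have [g [gP gb]] := series_exists k (sqrt_coef a) N20.
exists g; have ggP : on_grid (N * 2) (k + k) (g * g) by exact: on_grid_conv.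
apply: (on_grid_ext ggP fP2) => m.
rewrite [LHS](conv_grid _ N20 gP gP) -[RHS](sqrt_coefP _ a0).
by apply: eq_bigr => i _; rewrite !gb.
Qed.

Lemma lead_sqrt f q c : lead f (q + q) c ->
  exists g d, [/\ g * g = f, lead g q d & d * d = c].
Proof.
move=> fc; have [g gf] := puiseux_sqrt f.
have gq : lead g q (g q).
  have [->//|g0] := eqVneq g 0.
  (* A term of [g] of order below [q] would give [f] a nonzero coefficient below [q + q]. *)
  have [gv gmin] := pvalP g0; split=> // r rq.
  have := leadM (lead_pval g0) (lead_pval g0); rewrite gf => -[_ fv].
  apply/eqP; apply: contraTT rq => /gmin vr; rewrite -leNgt (le_trans _ vr)//.
  rewrite leNgt; apply/negP => vq; case: fc => fc _; move: fv; rewrite fc.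
    by move/esym/eqP; rewrite mulf_eq0 (negPf gv).
  by rewrite ltrD.
exists g, (g q); split=> //.
by have := leadM gq gq; rewrite gf => -[_ <-]; case: fc.
Qed.

(* Newton's method degenerates at a double root, so the root is found from the
   quadratic formula instead. *)
Lemma quadratic_lift f g h e w (a b c s : K) :
  lead f (e - w - w) a -> lead g (e - w) b -> lead h e c ->
  ~~ [&& a == 0, b == 0 & c == 0] -> a * s ^+ 2 + b * s + c = 0 ->
  exists x, lead x w s /\ f * x ^+ 2 + g * x + h = 0.
Proof.
move=> fa gb hc nz0 root_s; have [y ys] := monomial_exists w s.
(* Substituting [x = y + z] gives the equation [f z^2 + g' z + h' = 0]. Since [s] is a root, [h']
   has coefficient 0 at [t^e], and a solution [z] with coefficient 0 at [t^w] is wanted. *)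
pose g' := f * y + f * y + g; pose b' := a * s + a * s + b.
pose h' := f * y ^+ 2 + g * y + h.
have fy : lead (f * y) (e - w) (a * s) by have := leadM fa ys; rewrite subrK.
have g'b : lead g' (e - w) b' by apply: leadD => //; exact: leadD.
have h'c : lead h' e 0.
  rewrite -root_s; apply: leadD => //; apply: leadD.
    by have := leadM fy ys; rewrite subrK !expr2 !mulrA.
  by have := leadM gb ys; rewrite subrK.
suff [z [z0 zE]] : exists z, lead z w 0 /\ f * z ^+ 2 + g' * z + h' = 0.
  exists (y + z); split; first by rewrite -[s]addr0; exact: leadD.
  by rewrite -[RHS]zE /h' /g'; ring.
have [D [d [DE Dd dE]]] : exists D d, [/\ D * D = g' * g' - (f * h') *+ 4,
    lead D (e - w) d & d * d = b' * b'].
  apply: lead_sqrt; rewrite -[b' * b']subr0; apply: leadD; first exact: leadM.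
  have := leadM fa h'c; rewrite mulr0.
  have -> : e - w - w + e = e - w + (e - w) by rewrite -[LHS]addrA [- w + e]addrC.
  move=> fh0; have := leadN (leadD (leadD fh0 fh0) (leadD fh0 fh0)).
  rewrite !addr0; congr lead; ring.
(* The sign of the square root [D] of the discriminant is chosen so that [D] and [g'] have the same
   coefficient at order [e - w]. *)
wlog db : D d DE Dd dE / d = b'.
  move=> wl; have /eqP := dE; rewrite -!expr2 eqf_sqr => /orP[/eqP db|/eqP db].
    exact: (wl D d).
  apply: (wl (- D) (- d)); rewrite ?mulrNN//; last by rewrite db opprK.
  exact: leadN.
(* At a double root [a] is nonzero, so the usual formula with denominator [f + f] applies; its
   numerator cancels at order [e - w]. *)
have [b0|b0] := eqVneq b' 0.
  have a0 : a != 0.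
    apply: contraNneq nz0 => a0; move: b0 root_s; rewrite /b' a0 !mul0r !add0r.
    by move=> -> ; rewrite mul0r add0r => ->; rewrite !eqxx.
  have f0 : f != 0 by apply: lead_neq0 fa.
  exists ((D - g') / (f + f)); split.
    have := leadM (leadD Dd (leadN g'b)) (leadV _ (leadD fa fa)).
    rewrite db subrr mul0r -mulr2n mulrn_eq0/= => /(_ a0).
    by congr (lead _ _ _); ring.
  have ff : f + f != 0.
    by apply: (@lead_neq0 _ _ (e - w - w) (a + a)); [rewrite -mulr2n mulrn_eq0|exact: leadD].
  have : D * D - g' * g' + f * h' *+ 4 = 0 by rewrite DE; ring.
  move: ff f0 => ff f0 e0.
  transitivity ((D * D - g' * g' + f * h' *+ 4) * f / (f + f) ^+ 2).
    by field; rewrite ff.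
  by rewrite e0 !mul0r.
(* At a simple root [a] may vanish, so the conjugate form [- 2 h' / (g' + D)] is used, whose
   denominator has the nonzero leading coefficient [b' + b']. *)
have gD : lead (g' + D) (e - w) (b' + b') by rewrite -{2}db; exact: leadD.
have bb : b' + b' != 0 by rewrite -mulr2n mulrn_eq0.
have gD0 := lead_neq0 bb gD.
exists (- (h' + h') / (g' + D)); split.
  have := leadM (leadN (leadD h'c h'c)) (leadV bb gD).
  by rewrite addr0 oppr0 mul0r subKr.
transitivity (h' * (D * D - g' * g' + f * h' *+ 4) / (g' + D) ^+ 2).
  by field.
by rewrite DE; ring.
Qed.

End QuadraticLift.

(** * Permutations and their undirected cycles *)

Section Orbits.
Variable T : finType.
Implicit Types (s t : {perm T}) (x y : T) (c : {set T}).

Lemma porbit_step s x y : (s y \in porbit s x) = (y \in porbit s x).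
Proof. by rewrite -!eq_porbit_mem -{1}[s y]/((s ^+ 1)%g y) porbit_perm. Qed.

Lemma porbit_stepV s x y : ((s^-1)%g y \in porbit s x) = (y \in porbit s x).
Proof. by rewrite -porbit_step permKV. Qed.

Lemma porbit_min s x c :
  x \in c -> (forall y, y \in c -> s y \in c) -> porbit s x \subset c.
Proof.
move=> xc cs; apply/fintype.subsetP => y /porbitP[i ->].
by elim: i => [|i IH]; rewrite ?perm1// expgSr permM cs.
Qed.

(** Permutations with the same monomial may run through a cycle in opposite directions, hence the
    two alternatives. *)
Lemma porbit_same s t x : (forall y, s y = t y \/ t (s y) = y) ->
  porbit s x \subset porbit t x.
Proof.
move=> st; apply: porbit_min => [|y yx]; first exact: porbit_id.
case: (st y) => [->|tsy]; first by rewrite porbit_step.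
by rewrite -porbit_step tsy.
Qed.

(** Each orbit contributes 1 in total. As the sign of a permutation is given by its number of
    orbits, signs can be compared point by point through orbit sizes. *)
Lemma sum_inv_card_porbit s :
  \sum_x (#|porbit s x|%:R : rat)^-1 = #|porbits s|%:R.
Proof.
rewrite (partition_big_imset (porbit s)) /= -sum1_card natr_sum.
apply: eq_bigr => _ /imsetP[y _ ->].
rewrite (eq_bigr (fun=> (#|porbit s y|%:R)^-1)) => [|x /eqP -> //].
rewrite (eq_bigl [in porbit s y]) => [|x]; last by rewrite eq_porbit_mem.
rewrite !sumr_const -[LHS]mulr_natr mulVf//.
by rewrite pnatr_eq0 card_porbit_neq0.
Qed.

Lemma eq_odd_perm s t :
  (forall x, #|porbit s x| = #|porbit t x|) -> odd_perm s = odd_perm t.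
Proof.
move=> st; rewrite /odd_perm; congr (_ (+) odd _).
apply/eqP; rewrite -(eqr_nat rat) -!sum_inv_card_porbit; apply/eqP.
by apply: eq_bigr => x _; rewrite st.
Qed.

(** The positions serve modulo 2 to two-colour an even cycle and modulo 4 to write down a kernel
    vector. *)
Lemma porbit_position s x : exists pos : T -> nat,
  pos x = 0%N /\
  forall y, y \in porbit s x -> pos (s y) = ((pos y).+1 %% #|porbit s x|)%N.
Proof.
set L := #|porbit s x|; exists (fun y => index y (traject s x L)).
have L0 : (0 < L)%N by rewrite lt0n card_porbit_neq0.
have ind i : (i < L)%N -> index (iter i s x) (traject s x L) = i.
  move=> iL; rewrite -(nth_traject s iL) index_uniq ?size_traject//.
  exact: uniq_traject_porbit.
have idx : index x (traject s x L) = 0%N by exact: (ind 0%N).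
split=> // y; rewrite porbit_traject => /trajectP[i iL ->]; rewrite ind//.
rewrite -[s _]/(iter i.+1 s x); have [iL1|] := ltnP i.+1 L.
  by rewrite ind// modn_small.
move=> Li; have -> : i.+1 = L by apply/eqP; rewrite eqn_leq iL.
by rewrite iter_porbit idx modnn.
Qed.

Section Alternate.
Variables (s : {perm T}) (c : {set T}) (chi : pred T).
Hypotheses (cs : forall x, (s x \in c) = (x \in c))
  (chis : forall x, x \in c -> chi (s x) = ~~ chi x).

(** On [c], a point coloured by [chi] is exchanged with its successor, so each cycle inside [c] is
    replaced by one of its two perfect matchings. *)
Definition alternate_fun x :=
  if x \in c then if chi x then s x else (s^-1)%g x else s x.

Let csV x : ((s^-1)%g x \in c) = (x \in c).
Proof. by rewrite -cs permKV. Qed.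

Let chisV x : x \in c -> chi ((s^-1)%g x) = ~~ chi x.
Proof. by move=> xc; rewrite -[x in RHS](permKV s) chis ?csV// negbK. Qed.

Let alternate_stable x : (alternate_fun x \in c) = (x \in c).
Proof.
rewrite /alternate_fun; case: ifP => xc; last by rewrite cs.
by case: ifP => _; rewrite ?cs ?csV.
Qed.

Let alternate_funK x : x \in c -> alternate_fun (alternate_fun x) = x.
Proof.
move=> xc; rewrite [LHS]/alternate_fun alternate_stable xc /alternate_fun xc.
by case: (boolP (chi x)) => chix; rewrite ?chis ?chisV// ?chix ?(negPf chix)/= ?permK ?permKV.
Qed.

Let alternate_inj : injective alternate_fun.
Proof.
move=> x y xy; have := alternate_stable x; rewrite xy alternate_stable => yxc.
have [xc|xc] := boolP (x \in c).
  by rewrite -(alternate_funK xc) xy alternate_funK// yxc.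
by move: xy; rewrite /alternate_fun yxc (negPf xc); exact: perm_inj.
Qed.

Definition alternate := perm alternate_inj.

Lemma alternateE x : alternate x =
  if x \in c then if chi x then s x else (s^-1)%g x else s x.
Proof. by rewrite permE. Qed.

Lemma porbit_alternate_out x : x \notin c -> porbit alternate x = porbit s x.
Proof.
move=> xc; have h y : y \notin c -> alternate y = s y.
  by rewrite alternateE => /negPf ->.
have hX m : (alternate ^+ m)%g x = (s ^+ m)%g x /\ (s ^+ m)%g x \notin c.
  elim: m => [|m [IH mc]]; first by rewrite !perm1.
  by rewrite !expgSr !permM IH h// cs.
by apply/setP => y; apply/porbitP/porbitP => -[m ->]; exists m; rewrite (hX m).1.
Qed.

Lemma porbit_alternate_in x : x \in c -> porbit alternate x = [set x; alternate x]%SET.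
Proof.
move=> xc; apply/eqP; rewrite finset.eqEsubset; apply/andP; split.
  apply: porbit_min => [|y]; first by rewrite !inE eqxx.
  rewrite !inE => /orP[/eqP ->|/eqP ->]; first by rewrite eqxx orbT.
  by rewrite !permE alternate_funK// eqxx.
apply/fintype.subsetP => y; rewrite !inE => /orP[/eqP ->|/eqP ->]; first exact: porbit_id.
by rewrite porbit_step porbit_id.
Qed.

Lemma alternate_neq x : x \in c -> alternate x != x.
Proof.
move=> xc; rewrite alternateE xc; apply/eqP; case: ifP => chix e.
  by have := chis xc; rewrite e chix.
by have := chisV xc; rewrite e chix.
Qed.

End Alternate.

(** The cycle of length [2m] becomes [m] transpositions, so the number of orbits grows by
    [m - 1]. *)
Lemma odd_alternate s x chi m
    (cs : forall y, (s y \in porbit s x) = (y \in porbit s x))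
    (chis : forall y, y \in porbit s x -> chi (s y) = ~~ chi y) :
  #|porbit s x| = m.*2 -> odd_perm (alternate cs chis) = odd_perm s (+) ~~ odd m.
Proof.
move=> cm; set t := alternate _ _; set c := porbit s x in cs chis cm t *.
suff e : (#|porbits t| + 1)%N = (#|porbits s| + m)%N.
  have := congr1 odd e; rewrite !oddD /odd_perm addbT => /negbRL ->.
  by rewrite -addbA; congr (_ (+) _); case: odd; case: odd.
apply/eqP; rewrite -(eqr_nat rat) !natrD -!sum_inv_card_porbit.
rewrite !(bigID (mem c) predT) /=.
rewrite (eq_bigr (fun=> 2^-1)) => [|y yc]; last first.
  by rewrite porbit_alternate_in// cards2 eq_sym alternate_neq.
rewrite [X in X + _ + 1 == _]sumr_const.
rewrite [X in _ == X + _ + _](eq_bigr (fun=> #|c|%:R^-1)) => [|y]; last first.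
  by rewrite -eq_porbit_mem => /eqP ->.
rewrite [X in _ == X + _ + _]sumr_const -[X in _ == X + _ + _]mulr_natr.
rewrite mulVf ?pnatr_eq0 ?card_porbit_neq0//.
rewrite (eq_bigr (fun y => (#|porbit s y|%:R)^-1)) => [|y yc]; last first.
  by rewrite porbit_alternate_out.
have -> : 2^-1 *+ #|c| = m%:R :> rat by rewrite cm -[LHS]mulr_natr -mul2n natrM mulKf.
by apply/eqP; ring.
Qed.

End Orbits.

Section SymmetricMonomials.
Variable n : nat.
Implicit Types (s t : 'S_n) (i j : 'I_n) (k : 'I_(symdim n)) (c : {set 'I_n}).

Lemma symvarC i j : symvar i j = symvar j i.
Proof.
congr enum_rank; apply/val_inj; rewrite /= /sort_pair.
by case: ltngtP => // ij; congr (_, _); apply/val_inj.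
Qed.

Lemma symvar_inj i j i' j' : symvar i j = symvar i' j' ->
  (i = i' /\ j = j') \/ (i = j' /\ j = i').
Proof.
move=> /enum_rank_inj /(congr1 val) /=; rewrite /sort_pair.
by case: ifP => _; case: ifP => _ [-> ->]; auto.
Qed.

Lemma symvar_ex k : exists i j, k = symvar i j.
Proof.
exists (val (enum_val k)).1, (val (enum_val k)).2.
rewrite -[LHS]enum_valK; congr enum_rank; apply/val_inj => /=.
by rewrite /sort_pair (valP (enum_val k)) -surjective_pairing.
Qed.

(* The incidence matrix of the complete graph with loops, whose loops have
   both ends at the same vertex. *)
Definition incid j k : nat :=
  ((val (enum_val k)).1 == j) + ((val (enum_val k)).2 == j).

Lemma incid_symvar j i i' : incid j (symvar i i') = ((i == j) + (i' == j))%N.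
Proof.
by rewrite /incid enum_rankK /= /sort_pair; case: ifP => // _; rewrite addnC.
Qed.

Lemma perm_monomialE s k : perm_monomial s k = (\sum_i (symvar i (s i) == k))%N.
Proof. by rewrite /perm_monomial mnm_sumE; apply: eq_bigr => i _; rewrite mnm1E. Qed.

Lemma perm_monomial_neq0 s k :
  reflect (exists i, k = symvar i (s i)) (perm_monomial s k != 0%N).
Proof.
rewrite perm_monomialE sum_nat_eq0 negb_forall.
apply: (iffP existsP) => [[i h]|[i ->]]; exists i; last by rewrite eqxx.
by move: h; rewrite eqb0 negbK => /eqP.
Qed.

Lemma perm_monomial_edge s i : perm_monomial s (symvar i (s i)) != 0%N.
Proof. by apply/perm_monomial_neq0; exists i. Qed.

Lemma perm_monomial_symvar s i j : perm_monomial s (symvar i j) != 0%N ->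
  s i = j \/ s j = i.
Proof. by move=> /perm_monomial_neq0[l /symvar_inj[] [-> ->]]; auto. Qed.

Lemma porbit_perm_monomial s t : perm_monomial s = perm_monomial t ->
  porbit s =1 porbit t.
Proof.
move=> st i; have sub s' t' : perm_monomial s' = perm_monomial t' ->
    porbit s' i \subset porbit t' i.
  move=> e; apply: porbit_same => j; have := perm_monomial_edge s' j.
  by rewrite e => /perm_monomial_symvar[->|]; auto.
by apply/eqP; rewrite finset.eqEsubset !sub.
Qed.

Lemma odd_perm_monomial s t : perm_monomial s = perm_monomial t ->
  odd_perm s = odd_perm t.
Proof. by move=> /porbit_perm_monomial st; apply: eq_odd_perm => i; rewrite st. Qed.

Lemma long_even_cycles_monomial s t : perm_monomial s = perm_monomial t ->
  long_even_cycles s = long_even_cycles t.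
Proof.
move=> /porbit_perm_monomial st; apply/setP => c; rewrite !inE; congr (_ && _).
by rewrite /porbits (eq_imset _ st).
Qed.

Lemma long_even_cyclesP s c : reflect
  (exists i, [/\ c = porbit s i, ~~ odd #|c| & (4 <= #|c|)%N])
  (c \in long_even_cycles s).
Proof.
rewrite !inE; apply: (iffP and3P) => [[/imsetP[i _ ci] co c4]|[i [ci co c4]]].
  by exists i.
by split=> //; rewrite ci imset_f.
Qed.

(** Every vertex has one outgoing and one incoming edge in the graph of [s]; at a fixed point these
    are the two ends of the loop. *)
Lemma sum_perm_incid s j :
  (\sum_k incid j k * perm_monomial s k)%N = 2%N.
Proof.
transitivity (\sum_i incid j (symvar i (s i)))%N.
  under eq_bigr => k _ do rewrite perm_monomialE big_distrr.
  rewrite exchange_big; apply: eq_bigr => i _ /=.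
  rewrite (bigD1 (symvar i (s i)))//= eqxx muln1 big1 ?addn0// => k /negPf.
  by rewrite eq_sym => ->; rewrite muln0.
under eq_bigr => i _ do rewrite incid_symvar.
rewrite big_split /= (bigD1 j)//= eqxx big1 => [|i /negPf -> //].
rewrite (bigD1 ((s^-1)%g j))//= permKV eqxx big1// => i.
by rewrite -(can2_eq (permK s) (permKV s)) => /negPf ->.
Qed.

Lemma perm_monomial_le2 s k : (perm_monomial s k <= 2)%N.
Proof.
have [i [j ->]] := symvar_ex k; rewrite -[leqRHS](sum_perm_incid s i).
rewrite (bigD1 (symvar i j))//= incid_symvar eqxx.
by rewrite -[leqLHS]mul1n (leq_trans _ (leq_addr _ _))// leq_mul2r orbT.
Qed.

Lemma split_cycle s c : c \in long_even_cycles s -> exists s1 s2,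
  [/\ forall k, (perm_monomial s1 k + perm_monomial s2 k = (perm_monomial s k).*2)%N,
      long_even_cycles s1 = long_even_cycles s :\ c,
      long_even_cycles s2 = long_even_cycles s :\ c,
      odd_perm s1 = odd_perm s (+) (4 %| #|c|)%N &
      odd_perm s2 = odd_perm s (+) (4 %| #|c|)%N].
Proof.
move=> cs; have /long_even_cyclesP[x [cx co c4]] := cs.
have [pos [_ posS]] := porbit_position s x.
move: cs co c4; rewrite {}cx => cs co c4; pose m := #|porbit s x|./2.
have cm : #|porbit s x| = m.*2 by rewrite /m even_halfK.
have st i : (s i \in porbit s x) = (i \in porbit s x) by exact: porbit_step.
(* The length is even, so the parity of the position alternates also where the cycle closes up; the
   two parities give the two matchings. *)
pose chi i := odd (pos i); pose chi' i := ~~ chi i.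
have chis i : i \in porbit s x -> chi (s i) = ~~ chi i.
  by move=> /posS; rewrite /chi => ->; rewrite cm -mul2n odd_mod// mul2n odd_double.
have chis' i : i \in porbit s x -> chi' (s i) = ~~ chi' i.
  by move=> /chis; rewrite /chi' => ->.
have lecE ch (chs : forall i, i \in porbit s x -> ch (s i) = ~~ ch i) :
    long_even_cycles (alternate st chs) = long_even_cycles s :\ porbit s x.
  apply/setP => d; apply/long_even_cyclesP/idP.
    move=> [i [-> od d4]]; have [ic|ic] := boolP (i \in porbit s x).
      by move: d4; rewrite porbit_alternate_in// cards2; case: (_ != _).
    rewrite porbit_alternate_out// in od d4 *.
    rewrite finset.in_setD1 eq_porbit_mem ic; apply/long_even_cyclesP.
    by exists i.
  rewrite finset.in_setD1 => /andP[dc /long_even_cyclesP[i [di od d4]]].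
  exists i; split=> //; rewrite porbit_alternate_out//.
  by apply: contraNN dc; rewrite -eq_porbit_mem di.
have oddE ch (chs : forall i, i \in porbit s x -> ch (s i) = ~~ ch i) :
    odd_perm (alternate st chs) = odd_perm s (+) (4 %| #|porbit s x|)%N.
  rewrite (odd_alternate st chs cm) cm; congr (_ (+) _).
  by rewrite -dvdn2 -[4%N]/(2 * 2)%N -muln2 dvdn_pmul2r.
exists (alternate st chis), (alternate st chis'); split; rewrite ?lecE ?oddE// => k.
rewrite !perm_monomialE -addnn -!big_split/= !(bigID [in porbit s x] predT)/=.
congr addn; last first.
  by apply: eq_bigr => i ic; rewrite !alternateE (negPf ic).
(* At each vertex [i] of the cycle the two matchings use the edges to [s i] and to [s^-1 i] in some
   order; reindexing one copy of the sum by [s^-1] matches the terms. *)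
rewrite !big_split/= [X in _ = (_ + X)%N](reindex_inj (@perm_inj _ (s^-1)%g))/=.
rewrite [X in _ = (_ + X)%N](eq_bigl [in porbit s x]) => [|i]; last exact: porbit_stepV.
rewrite -!big_split/=; apply: eq_bigr => i ic; rewrite !alternateE ic permKV /chi'.
by rewrite [symvar ((s^-1)%g i) i]symvarC; case: (chi i) => //=; rewrite addnC.
Qed.

End SymmetricMonomials.

(** * Balanced edge weights on the graph of a permutation *)

Section BalancedVectors.
Variables (R : realFieldType) (n : nat) (s : 'S_n).
Implicit Types (z d : 'I_(symdim n) -> R) (i j : 'I_n) (k : 'I_(symdim n)).
Local Notation edge i := (symvar i (s i)).

(** Differences of points of the polytope supported on the graph of [s] are of this kind, because
    all vertex degrees are 2. *)
Definition balanced z :=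
  (forall k, perm_monomial s k = 0%N -> z k = 0) /\
  (forall j, \sum_k (incid j k)%:R * z k = 0).

(** Within the graph only [edge i] and [edge (s i)] meet the vertex [s i], so their weights cancel.
    If the two edges coincide, the weight is 0. *)
Lemma balanced_next z i : balanced z -> z (edge (s i)) = - z (edge i).
Proof.
move=> [supp bal]; have := bal (s i).
have z0 k : k != edge i -> k != edge (s i) -> (incid (s i) k)%:R * z k = 0.
  move=> ki ksi; have [/supp->|] := eqVneq (perm_monomial s k) 0%N; first by rewrite mulr0.
  move=> /perm_monomial_neq0[l kl]; rewrite kl incid_symvar.
  have /negPf-> : l != s i by apply: contraNneq ksi => <-; rewrite kl.
  have /negPf-> : s l != s i.
    by apply: contraNneq ki => /perm_inj <-; rewrite kl.
  by rewrite mul0r.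
rewrite (bigD1 (edge i))//=; have [e|e] := eqVneq (edge (s i)) (edge i).
  rewrite big1 => [|k ki]; last by rewrite z0// e.
  rewrite addr0 => /eqP; rewrite mulf_eq0 pnatr_eq0 incid_symvar eqxx addn1/=.
  by move=> /eqP; rewrite e => ->; rewrite oppr0.
have si : s i != i by apply: contraNneq e => si; rewrite !si.
rewrite (bigD1 (edge (s i)))//= big1 => [|k /andP[]]; last exact: z0.
rewrite !incid_symvar eqxx eq_sym (negPf si) (inj_eq perm_inj) (negPf si).
by rewrite addr0 !mul1r addrC => /eqP; rewrite addr_eq0 => /eqP.
Qed.

Lemma balanced_iter z i m : balanced z ->
  z (edge ((s ^+ m)%g i)) = (-1) ^+ m * z (edge i).
Proof.
move=> bz; elim: m => [|m IH]; first by rewrite perm1 mul1r.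
by rewrite expgSr permM balanced_next// IH exprS mulN1r mulNr.
Qed.

(** Around an odd cycle the alternating sign returns reversed, and on a transposition [edge i] and
    [edge (s i)] coincide. *)
Lemma balanced_short z i : balanced z -> porbit s i \notin long_even_cycles s ->
  z (edge i) = 0.
Proof.
move=> bz il; apply/eqP; rewrite -eqNr; apply/eqP.
have [oi|ei] := boolP (odd #|porbit s i|).
  by have := balanced_iter i #|porbit s i| bz; rewrite permX iter_porbit -signr_odd oi mulN1r.
have i2 : #|porbit s i| = 2.
  have : (#|porbit s i| < 4)%N.
    by rewrite ltnNge; apply: contraNN il => i4; apply/long_even_cyclesP; exists i.
  by have := card_porbit_neq0 s i; move: ei; case: #|_| => [|[|[|[|]]]].
have ss : s (s i) = i by have := iter_porbit s i; rewrite i2.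
by rewrite -balanced_next// ss symvarC.
Qed.

Lemma balanced_eq0 z k : balanced z -> long_even_cycles s = finset.set0 -> z k = 0.
Proof.
move=> bz l0; have [/(proj1 bz)//|/perm_monomial_neq0[i ->]] := eqVneq (perm_monomial s k) 0%N.
by apply: balanced_short; rewrite ?l0 ?finset.in_set0.
Qed.

(** The weights vanish off [c] and alternate along it, so a single value determines them. *)
Lemma balanced_proportional z d c k0 : long_even_cycles s = [set c]%SET ->
  balanced z -> balanced d -> d k0 != 0 -> forall k, z k = z k0 / d k0 * d k.
Proof.
move=> sc bz bd d0 k.
have [pk|/perm_monomial_neq0[i ki]] := eqVneq (perm_monomial s k) 0%N.
  by rewrite (proj1 bz k)// (proj1 bd k)// mulr0.
have /perm_monomial_neq0[i0 ki0] : perm_monomial s k0 != 0%N.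
  by apply: contraNneq d0 => /(proj1 bd) ->.
have i0c : porbit s i0 = c.
  apply/eqP; apply: contraNT d0 => i0c; rewrite ki0 balanced_short//.
  by rewrite sc finset.in_set1.
have [ic|ic] := eqVneq (porbit s i) c; last first.
  by rewrite ki (balanced_short bz) ?(balanced_short bd) ?sc ?finset.in_set1// mulr0.
have /porbitP[m im] : i \in porbit s i0 by rewrite i0c -ic porbit_id.
rewrite ki im !balanced_iter// -ki0 mulrCA; congr (_ * _).
by rewrite divfK.
Qed.

End BalancedVectors.

Lemma det_cycle_graph (R : fieldType) n (s : 'S_n) c :
  c \in long_even_cycles s -> (4 %| #|c|)%N ->
  \det (sym_mx (\row_k (perm_monomial s k != 0%N)%:R) : 'M[R]_n) = 0.
Proof.
move=> /long_even_cyclesP[x [-> _ _]] c4.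
have [pos [posx posS]] := porbit_position s x.
(* The signs (1, 0, -1, 0) repeated along the cycle are in the kernel. *)
pose u m : R := if (m %% 4 == 0)%N then 1 else if (m %% 4 == 2)%N then -1 else 0.
have uE m m' : (m %% 4 = (m' + 2) %% 4)%N -> u m = - u m'.
  move=> mm; rewrite /u mm -modnDml; have : (m' %% 4 < 4)%N by exact: ltn_pmod.
  by case: (m' %% 4)%N => [|[|[|[|]]]]//=; rewrite ?oppr0 ?opprK.
have pos2 i : i \in porbit s x -> (pos (s (s i)) %% 4 = (pos i + 2) %% 4)%N.
  move=> ic; rewrite !posS ?porbit_step// modn_dvdm// -[in LHS]addn1 -modnDml.
  by rewrite modn_dvdm// modnDml !addn1 addn2.
pose v := \row_i (if i \in porbit s x then u (pos i) else 0).
apply/eqP/det0P; exists v.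
  apply/eqP => /rowP/(_ x); rewrite !mxE porbit_id posx => /eqP.
  by rewrite oner_eq0.
apply/rowP => j; rewrite !mxE.
have A0 i : i != s j -> i != (s^-1)%g j ->
    v 0 i * sym_mx (\row_k (perm_monomial s k != 0%N)%:R) i j = 0.
  move=> ij ij'; rewrite !mxE; case: eqP => [_|/eqP/perm_monomial_symvar[h|h]].
  - by rewrite mulr0.
  - by rewrite -h permK eqxx in ij'.
  - by rewrite h eqxx in ij.
have [jc|jc] := boolP (j \in porbit s x); last first.
  apply: big1 => i _; have [->|ij] := eqVneq i (s j).
    by rewrite mxE porbit_step (negPf jc) mul0r.
  have [->|ij'] := eqVneq i ((s^-1)%g j); last exact: A0.
  by rewrite mxE porbit_stepV (negPf jc) mul0r.
have jV : (s^-1)%g j \in porbit s x by rewrite porbit_stepV.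
(* The two neighbours of [j] have positions that differ by 2 modulo 4, so they are distinct and
   their values of [u] cancel. *)
have ne : (s^-1)%g j != s j.
  apply/eqP => e; have := pos2 _ jV; rewrite permKV -e -modnDml.
  have : (pos ((s^-1)%g j) %% 4 < 4)%N by exact: ltn_pmod.
  by case: (_ %% 4)%N => [|[|[|[|]]]].
rewrite (bigD1 (s j))//= (bigD1 ((s^-1)%g j))//= big1 => [|i /andP[]]; last exact: A0.
rewrite !mxE porbit_step jc jV addr0 [symvar (s j) j]symvarC perm_monomial_edge.
have := perm_monomial_edge s ((s^-1)%g j); rewrite permKV => ->.
by rewrite !mulr1 (uE _ (pos ((s^-1)%g j))) ?addNr// -pos2// permKV.
Qed.

(** * The Newton polytope *)

Section DotProduct.
Variables (R : realType) (N : nat).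
Implicit Types (w x y : 'rV[R]_N) (t : R).

Lemma dotDr w x y : dot w (x + y) = dot w x + dot w y.
Proof. by rewrite -big_split; apply: eq_bigr => k _; rewrite mxE mulrDr. Qed.

Lemma dotZr w t x : dot w (t *: x) = t * dot w x.
Proof. by rewrite mulr_sumr; apply: eq_bigr => k _; rewrite mxE mulrCA. Qed.

Lemma dotC w x : dot w x = dot x w.
Proof. by apply: eq_bigr => k _; rewrite mulrC. Qed.

Lemma dotDl w x y : dot (w + x) y = dot w y + dot x y.
Proof. by rewrite !(dotC _ y) dotDr. Qed.

Lemma dotZl w t x : dot (t *: w) x = t * dot w x.
Proof. by rewrite !(dotC _ x) dotZr. Qed.

Lemma dotBr w x y : dot w (x - y) = dot w x - dot w y.
Proof. by rewrite dotDr -scaleN1r dotZr mulN1r. Qed.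

Lemma dotBl w x y : dot (w - x) y = dot w y - dot x y.
Proof. by rewrite !(dotC _ y) dotBr. Qed.

Lemma dot_ge0 x : 0 <= dot x x.
Proof. by apply: sumr_ge0 => k _; rewrite -expr2 sqr_ge0. Qed.

Lemma dot_eq0 x : dot x x = 0 -> x = 0.
Proof.
move/eqP; rewrite psumr_eq0 => [/allP x0|k _]; last by rewrite -expr2 sqr_ge0.
apply/rowP => k; rewrite mxE; apply/eqP; rewrite -sqrf_eq0 expr2.
exact: (implyP (x0 k (mem_index_enum _))).
Qed.

End DotProduct.

(** * Finite minimization and perturbation *)

Section FiniteOptimization.
Variables (R : realType) (I : finType).
Implicit Types (P : I -> Prop) (f g h : I -> R).

Lemma finite_argmin P f : (exists i, P i) ->
  exists i, P i /\ forall j, P j -> f i <= f j.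
Proof.
move=> [i0 Pi0]; have /asboolP Pi0' := Pi0.
case: (@arg_minP _ _ _ i0 (fun i => `[< P i >]) f Pi0') => i /asboolP Pi fi.
by exists i; split=> // j /asboolP; exact: fi.
Qed.

Lemma finite_lower_bound h : (forall i, 0 < h i) ->
  exists d, 0 < d /\ forall i, d <= h i.
Proof.
(* [S] exceeds every [(h i)^-1]; the summand 1 keeps it positive when [I] is empty. *)
move=> h0; pose S := 1 + \sum_i (h i)^-1.
have S0 : 0 < S by rewrite ltr_pwDl// sumr_ge0// => i _; rewrite invr_ge0 ltW.
exists S^-1; split=> [|i]; first by rewrite invr_gt0.
rewrite -[leRHS]invrK lef_pV2 ?posrE ?invr_gt0//.
rewrite /S (bigD1 i)//= addrCA lerDl addr_ge0// sumr_ge0// => j _.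
by rewrite invr_ge0 ltW.
Qed.

(** For small [d], adding [d * g] cannot outweigh a gap in [f] and only breaks ties. In this way a
    weight is perturbed to one that exposes a smaller face. *)
Lemma lexicographic_min P f g i0 :
  (forall i, P i -> f i0 <= f i) ->
  (forall i, P i -> f i = f i0 -> g i0 <= g i) ->
  exists d0, 0 < d0 /\ forall d, 0 < d -> d <= d0 -> forall i, P i ->
    f i0 + d * g i0 <= f i + d * g i /\
    (f i + d * g i = f i0 + d * g i0 -> f i = f i0 /\ g i = g i0).
Proof.
move=> fmin gmin.
pose h i := if f i0 < f i then (f i - f i0) / (`|g i - g i0| + 1) else 1.
have den i : 0 < `|g i - g i0| + 1 by rewrite ltr_wpDl.
have [|d0 [d00 d0h]] := @finite_lower_bound h.
  by move=> i; rewrite /h; case: ifP => // ?; rewrite divr_gt0// subr_gt0.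
exists d0; split=> // d d_gt0 dd0 i Pi; have := fmin _ Pi.
rewrite le_eqVlt => /orP[/eqP fi|fi].
  rewrite fi lerD2l ler_pM2l// gmin//; split=> // /addrI e; split=> //.
  by apply: (mulfI (lt0r_neq0 d_gt0)).
suff lt : f i0 + d * g i0 < f i + d * g i.
  by rewrite ltW//; split=> // e; rewrite e ltxx in lt.
have := le_trans dd0 (d0h i); rewrite /h fi ler_pdivlMr// mulrDr mulr1 => dh.
have : d * (g i0 - g i) <= d * `|g i - g i0|.
  by rewrite ler_pM2l// distrC ler_norm.
rewrite mulrBr; lra.
Qed.

End FiniteOptimization.

Section SymdetPolytope.
Variables (R : realType) (n : nat).
Implicit Types (s t a b : 'S_n) (k : 'I_(symdim n)) (w x y : 'rV[R]_(symdim n)).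
Local Notation pt := (perm_point R).
Local Notation P := (symdet_polytope R n).

Lemma perm_pointE s k : pt s 0 k = (perm_monomial s k)%:R.
Proof. by rewrite mxE. Qed.

Lemma exponent_vector_inj : injective (@exponent_vector R (symdim n)).
Proof.
move=> m m' /rowP mm; apply/mnmP => k; have := mm k; rewrite !mxE => /eqP.
by rewrite eqr_nat => /eqP.
Qed.

Lemma mcoeff_symdet m : mcoeff m (symdet n) =
  \sum_(s | perm_monomial s == m) (-1) ^+ s.
Proof.
rewrite symdetE raddf_sum [RHS]big_mkcond; apply: eq_bigr => s _ /=.
rewrite mulr_sign; case: (odd_perm s); rewrite ?raddfN /= mcoeffX.
  by case: eqP; rewrite ?oppr0.
by case: eqP.
Qed.

(** Permutations with the same monomial have the same sign, so nothing cancels. *)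
Lemma mcoeff_perm_monomial s : exists m, mcoeff (perm_monomial s) (symdet n) =
  (-1) ^+ s * m.+1%:Z.
Proof.
rewrite mcoeff_symdet (eq_bigr (fun=> (-1) ^+ s)) => [|t /eqP st].
  rewrite sumr_const; set c := #|_|; exists c.-1.
  rewrite prednK; first by rewrite -[LHS]mulr_natr natz.
  by apply/card_gt0P; exists s; exact: eqxx.
by rewrite (odd_perm_monomial st).
Qed.

Lemma mcoeff_neq0 m : mcoeff m (symdet n) != 0 -> exists s, perm_monomial s = m.
Proof.
apply: contra_neqP => /forallNP h; rewrite mcoeff_symdet big1// => s /eqP sm.
by have := h s.
Qed.

Lemma mcoeff_gt0 m : 0 < mcoeff m (symdet n) <->
  exists s, perm_monomial s = m /\ ~~ odd_perm s.
Proof.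
split=> [m0|[s [<- so]]]; last first.
  by have [l ->] := mcoeff_perm_monomial s; rewrite mulr_sign (negPf so).
have [s sm] := mcoeff_neq0 (lt0r_neq0 m0); exists s; split=> //; move: m0.
by have [l] := mcoeff_perm_monomial s; rewrite sm mulr_sign => ->; case: odd_perm.
Qed.

Lemma mcoeff_lt0 m : mcoeff m (symdet n) < 0 <->
  exists s, perm_monomial s = m /\ odd_perm s.
Proof.
split=> [m0|[s [<- so]]]; last first.
  by have [l ->] := mcoeff_perm_monomial s; rewrite mulr_sign so.
have [s sm] := mcoeff_neq0 (ltr0_neq0 m0); exists s; split=> //; move: m0.
by have [l] := mcoeff_perm_monomial s; rewrite sm mulr_sign => ->; case: odd_perm.
Qed.

Lemma has_both_signsE (E : set 'rV[R]_(symdim n)) :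
  has_both_signs_monomial E <-> has_both_signs_perm E.
Proof.
split=> [[m1 [m2 [E1 E2 /mcoeff_gt0[s1 [s1m o1]] /mcoeff_lt0[s2 [s2m o2]]]]]|].
  by exists s1, s2; split=> //; rewrite /perm_point ?s1m ?s2m.
move=> [s1 [s2 [E1 E2 o1 o2]]]; exists (perm_monomial s1), (perm_monomial s2).
by split=> //; [apply/mcoeff_gt0; exists s1|apply/mcoeff_lt0; exists s2].
Qed.

Lemma polytope_perm s : P (pt s).
Proof.
move=> A [_]; apply; exists (perm_monomial s) => //=.
have [m] := mcoeff_perm_monomial s; rewrite mcoeff_msupp => ->.
by rewrite mulf_neq0// signr_eq0.
Qed.

Lemma polytope_convex x y (r : R) : 0 <= r <= 1 -> P x -> P y ->
  P ((1 - r) *: x + r *: y).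
Proof.
move=> r01 Px Py A AP; have Ax := Px A AP; have Ay := Py A AP.
have [Ac _] := AP; have /andP[r0 r1] := r01.
have := Ac y x (Itv01 r0 r1); rewrite !inE => /(_ Ay Ax).
by rewrite addrC.
Qed.

Lemma polytope_ind (Q : 'rV[R]_(symdim n) -> Prop) :
  (forall s, Q (pt s)) ->
  (forall x y (r : R), 0 <= r <= 1 -> Q x -> Q y -> Q ((1 - r) *: x + r *: y)) ->
  forall y, P y -> Q y.
Proof.
move=> Qpt Qc y /(_ [set z | Q z]); apply; split.
  move=> x z r; rewrite !inE => Qx Qz; have := Qc z x r%:num.
  rewrite addrC; apply => //.
  exact/andP.
move=> _ [m + <-]; rewrite /= mcoeff_msupp => /mcoeff_neq0[s <-]; exact: Qpt.
Qed.

Definition minimizes w s := forall t, dot w (pt s) <= dot w (pt t).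

Lemma minimizes_polytope w s y : minimizes w s -> P y -> dot w (pt s) <= dot w y.
Proof.
move=> ws; move: y; apply: polytope_ind => // x y r /andP[r0 r1] hx hy.
rewrite dotDr !dotZr -[leLHS](subrK (r * dot w (pt s))) -[X in X - _]mul1r -mulrBl.
by apply: lerD; apply: ler_wpM2l => //; rewrite subr_ge0.
Qed.

Lemma minimizes_eq w s t : minimizes w s -> dot w (pt t) = dot w (pt s) ->
  minimizes w t.
Proof. by move=> ws st u; rewrite st. Qed.

Lemma minimizes_dot w s t : minimizes w s -> minimizes w t ->
  dot w (pt s) = dot w (pt t).
Proof. by move=> ws wt; apply/le_anti; rewrite ws wt. Qed.

Lemma segment_convex (a b x y : 'rV[R]_(symdim n)) (r : R) : 0 <= r <= 1 ->
  segment a b x -> segment a b y -> segment a b ((1 - r) *: x + r *: y).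
Proof.
move=> /andP[r0 r1] [p /andP[p0 p1] <-] [q /andP[q0 q1] <-].
exists ((1 - r) * p + r * q).
  apply/andP; split; first by rewrite addr_ge0// mulr_ge0// subr_ge0.
  rewrite -[leRHS](subrK r); apply: lerD.
    by rewrite ler_piMr// subr_ge0.
  by rewrite ler_piMr.
by apply/rowP => k; rewrite !mxE; ring.
Qed.

Lemma segment_l (a b : 'rV[R]_(symdim n)) : segment a b a.
Proof. by exists 0; rewrite /= ?lexx ?ler01// subr0 scale1r scale0r addr0. Qed.

Lemma segment_r (a b : 'rV[R]_(symdim n)) : segment a b b.
Proof. by exists 1; rewrite /= ?lexx ?ler01// subrr scale1r scale0r add0r. Qed.

Lemma dot_segment w (a b x : 'rV[R]_(symdim n)) : dot w a = dot w b ->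
  segment a b x -> dot w x = dot w a.
Proof. by move=> ab [r _ <-]; rewrite dotDr !dotZr -ab; ring. Qed.

Lemma face_segment w s t : minimizes w s -> dot w (pt t) = dot w (pt s) ->
  (forall u, dot w (pt u) = dot w (pt s) -> segment (pt s) (pt t) (pt u)) ->
  face P w = segment (pt s) (pt t).
Proof.
move=> ws wt seg; rewrite eqEsubset; split=> [x [Px xmin]|_ [r r01 <-]].
  have {xmin} : dot w x = dot w (pt s).
    by apply/le_anti; rewrite xmin ?minimizes_polytope//; exact: polytope_perm.
  (* The inequality is carried along in the induction because a proper convex combination then
     attains the minimum only if both of its ends do. *)
  suff [] : dot w (pt s) <= dot w x /\
    (dot w x = dot w (pt s) -> segment (pt s) (pt t) x) by [].
  move: x Px; apply: polytope_ind => [u|x y r r01 [x1 x2] [y1 y2]].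
    by split; [exact: ws|exact: seg].
  have [->|r0] := eqVneq r 0; first by rewrite subr0 scale1r scale0r addr0.
  have [->|r1] := eqVneq r 1; first by rewrite subrr scale1r scale0r add0r.
  have /andP[r0' r1'] := r01; rewrite dotDr !dotZr.
  set m := dot w (pt s) in x1 x2 y1 y2 *.
  have x0 : 0 <= (1 - r) * (dot w x - m) by rewrite mulr_ge0 ?subr_ge0.
  have y0 : 0 <= r * (dot w y - m) by rewrite mulr_ge0 ?subr_ge0.
  have e : (1 - r) * (dot w x - m) + r * (dot w y - m) =
    (1 - r) * dot w x + r * dot w y - m by ring.
  split; first by rewrite -subr_ge0 -e addr_ge0.
  move=> /eqP; rewrite -subr_eq0 -e paddr_eq0// !mulf_eq0 !subr_eq0.
  rewrite [1 == r]eq_sym (negPf r0) (negPf r1) /= => /andP[/eqP xm /eqP ym].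
  by apply: segment_convex => //; [exact: x2|exact: y2].
split; first by apply: polytope_convex => //; exact: polytope_perm.
move=> y Py; rewrite (@dot_segment w (pt s) (pt t))//; last by exists r.
exact: minimizes_polytope.
Qed.

Lemma normal_cone_minimizes (E : set 'rV[R]_(symdim n)) w s :
  normal_cone P E w -> E (pt s) -> minimizes w s.
Proof. by move=> wE Es t; apply: wE => //; exact: polytope_perm. Qed.

Lemma minimizes_normal_cone w s t : minimizes w s -> minimizes w t ->
  normal_cone P (segment (pt s) (pt t)) w.
Proof.
move=> ws wt x y Ex Py; rewrite (dot_segment _ Ex); last exact: minimizes_dot.
exact: minimizes_polytope.
Qed.

Lemma minimizes_avg w s s1 s2 : minimizes w s -> pt s1 + pt s2 = pt s + pt s ->
  minimizes w s1 /\ minimizes w s2.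
Proof.
move=> ws /(congr1 (dot w)); rewrite !dotDr => e.
have := ws s1; have := ws s2; split; apply: (minimizes_eq ws); lra.
Qed.

Lemma perm_point_split s c : c \in long_even_cycles s -> exists s1 s2,
  [/\ pt s1 + pt s2 = pt s + pt s, pt s1 != pt s,
      long_even_cycles s1 = long_even_cycles s :\ c,
      long_even_cycles s2 = long_even_cycles s :\ c &
      odd_perm s1 = odd_perm s (+) (4 %| #|c|)%N /\
      odd_perm s2 = odd_perm s (+) (4 %| #|c|)%N].
Proof.
move=> sc; have [s1 [s2 [pm l1 l2 o1 o2]]] := split_cycle sc.
exists s1, s2; split=> //.
  by apply/rowP => k; rewrite !mxE -!natrD pm addnn.
apply/eqP => /exponent_vector_inj/long_even_cycles_monomial l.
by move: sc; rewrite -l l1 !inE eqxx.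
Qed.

(* Its minimal face is spanned by the permutations whose edges all lie in the
   graph of s. *)
Definition off_support s : 'rV[R]_(symdim n) :=
  \row_k (perm_monomial s k == 0%N)%:R.

Lemma off_support_ge0 s t : 0 <= dot (off_support s) (pt t).
Proof. by apply: sumr_ge0 => k _; rewrite !mxE mulr_ge0. Qed.

Lemma off_support_eq0 s x : (forall k, 0 <= x 0 k) ->
  dot (off_support s) x = 0 <-> (forall k, perm_monomial s k = 0%N -> x 0 k = 0).
Proof.
move=> x0; split=> [/eqP|h].
  rewrite psumr_eq0 => [/allP h k sk|k _]; last by rewrite mulr_ge0// mxE.
  have := h k (mem_index_enum _); rewrite mxE sk eqxx mul1r.
  by move=> /eqP.
by apply: big1 => k _; rewrite mxE; case: eqP => [/h ->|_]; rewrite ?mulr0 ?mul0r.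
Qed.

Lemma off_support_self s : dot (off_support s) (pt s) = 0.
Proof. by apply/off_support_eq0 => k; rewrite mxE// => ->. Qed.

Lemma off_support_min s : minimizes (off_support s) s.
Proof. by move=> t; rewrite off_support_self off_support_ge0. Qed.

Lemma polytope_ge0 y : P y -> forall k, 0 <= y 0 k.
Proof.
move: y; apply: polytope_ind => [s k|x y r /andP[r0 r1] hx hy k]; first by rewrite mxE.
by rewrite !mxE addr_ge0// mulr_ge0// subr_ge0.
Qed.

Lemma polytope_incid y : P y -> forall j, \sum_k (incid j k)%:R * y 0 k = 2.
Proof.
move: y; apply: polytope_ind => [s j|x y r _ hx hy j].
  under eq_bigr => k _ do rewrite mxE -natrM.
  by rewrite -natr_sum sum_perm_incid.
under eq_bigr => k _ do rewrite !mxE mulrDr mulrCA [X in _ + X]mulrCA.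
by rewrite big_split /= -!mulr_sumr hx hy; ring.
Qed.

Lemma balanced_polytope s x y : P x -> P y -> dot (off_support s) x = 0 ->
  dot (off_support s) y = 0 -> balanced s (fun k => x 0 k - y 0 k).
Proof.
move=> Px Py /off_support_eq0 x0 /off_support_eq0 y0; split=> [k sk|j].
  by rewrite x0 ?y0 ?subr0//; exact: polytope_ge0.
under eq_bigr => k _ do rewrite mulrBr.
by rewrite sumrB !polytope_incid// subrr.
Qed.

Lemma off_support_vertex s t : long_even_cycles s = finset.set0 ->
  dot (off_support s) (pt t) = 0 -> pt t = pt s.
Proof.
move=> l0 ts; apply/rowP => k; apply/eqP; rewrite -subr_eq0; apply/eqP.
apply: (balanced_eq0 (z := fun k => pt t 0 k - pt s 0 k) k _ l0).
apply: balanced_polytope => //; try exact: polytope_perm.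
exact: off_support_self.
Qed.

(** Differences to [pt s] within the face are balanced, hence multiples of [pt s1 - pt s]; the
    bounds on exponents confine the multiplier [tau] to [[-1, 1]]. *)
Lemma off_support_edge s s1 s2 c : long_even_cycles s = [set c]%SET ->
  pt s1 + pt s2 = pt s + pt s -> pt s1 != pt s ->
  face P (off_support s) = segment (pt s1) (pt s2).
Proof.
move=> sc s12 s1s; have [w1 w2] := minimizes_avg (off_support_min s) s12.
have d1 := minimizes_dot w1 (off_support_min s).
have d2 := minimizes_dot w2 (off_support_min s).
apply: face_segment => // [|t]; rewrite ?d2// d1 off_support_self => ts.
rewrite off_support_self in d1 d2.
have bal u : dot (off_support s) (pt u) = 0 ->
    balanced s (fun k => pt u 0 k - pt s 0 k).
  by move=> us; apply: balanced_polytope; rewrite ?off_support_self//; exact: polytope_perm.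
have [k0 k0P] : exists k, pt s1 0 k - pt s 0 k != 0.
  apply: contra_neqP s1s => /forallNP h; apply/rowP => k; apply/eqP.
  by rewrite -subr_eq0; apply/negPn/negP/h.
have prop := balanced_proportional sc (bal _ ts) (bal _ d1) k0P.
pose tau : R := (pt t 0 k0 - pt s 0 k0) / (pt s1 0 k0 - pt s 0 k0).
have tE k : pt t 0 k = pt s 0 k + tau * (pt s1 0 k - pt s 0 k).
  by rewrite -[tau * _]prop addrC subrK.
suff tau1 : -1 <= tau <= 1.
  exists ((1 - tau) / 2).
    apply/andP; split; lra.
  apply/rowP => k; have := congr1 (fun v : 'rV_ _ => v 0 k) s12.
  rewrite tE !mxE; move: (_%:R) (_%:R) (_%:R) => p1 p2 p e.
  have -> : p2 = p1 + p1 - p by rewrite -e; ring.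
  by field.
(* On the consecutive edges [k0] and [k1] of the cycle, [s] has exponent 1 and [s1] differs from it
   by opposite units, so nonnegativity of [pt t] at both edges bounds [tau] from both sides. *)
have s0 : perm_monomial s k0 != 0%N.
  by apply: contraNneq k0P => /(proj1 (bal _ d1)) ->.
have /perm_monomial_neq0[i0 ki0] := s0.
pose k1 := symvar (s i0) (s (s i0)).
have s1k1 : perm_monomial s k1 != 0%N by exact: perm_monomial_edge.
have dk1 : pt s1 0 k1 - pt s 0 k1 = - (pt s1 0 k0 - pt s 0 k0).
  by rewrite ki0; apply: (balanced_next _ (bal _ d1)).
have nat12 k : (perm_monomial s1 k + perm_monomial s2 k =
    perm_monomial s k + perm_monomial s k)%N.
  apply/eqP; rewrite -(eqr_nat R) !natrD -!perm_pointE.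
  by have := congr1 (fun v : 'rV_ _ => v 0 k) s12; rewrite !mxE => ->.
have e01 : (perm_monomial s1 k1 + perm_monomial s1 k0 =
    perm_monomial s k1 + perm_monomial s k0)%N.
  by apply/eqP; rewrite -(eqr_nat R) !natrD -!perm_pointE; apply/eqP; move: dk1; lra.
have ne : perm_monomial s1 k0 <> perm_monomial s k0.
  by move=> e; move: k0P; rewrite !perm_pointE e subrr eqxx.
have t0 k : 0 <= pt t 0 k by rewrite mxE.
have := t0 k0; have := t0 k1; rewrite !tE dk1 !perm_pointE.
have := nat12 k0; have := nat12 k1; move: ne e01 s0 s1k1.
have := perm_monomial_le2 s1 k0; have := perm_monomial_le2 s1 k1.
have := perm_monomial_le2 s2 k0; have := perm_monomial_le2 s2 k1.
move: (perm_monomial s1 k0) (perm_monomial s1 k1) (perm_monomial s2 k0)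
  (perm_monomial s2 k1) (perm_monomial s k0) (perm_monomial s k1) => a1 b1 a2 b2 a b.
move=> h1 h2 h3 h4 h5 h6 h7 h8 h9 h10.
have -> : b = 1%N by lia.
have [[-> ->]|[-> ->]] : (a1 = 0%N /\ a = 1%N) \/ (a1 = 2%N /\ a = 1%N) by lia.
  by lra.
by lra.
Qed.

End SymdetPolytope.

(** * Edges with both signs in mixed faces *)

Section MixedEdges.
Variables (R : realType) (n : nat).
Implicit Types (s t a b : 'S_n) (k : 'I_(symdim n)) (w x y : 'rV[R]_(symdim n)).
Local Notation pt := (perm_point R).
Local Notation P := (symdet_polytope R n).

(** Splitting keeps minimality, since a minimizer is the midpoint of its two splittings, and keeps
    the sign when 4 does not divide the length. *)
Lemma split_cycles w s (D : {set {set 'I_n}}) : minimizes w s ->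
  D \subset long_even_cycles s -> exists t,
    [/\ minimizes w t, long_even_cycles t = long_even_cycles s :\: D &
        (forall c, c \in D -> ~~ (4 %| #|c|)%N) -> odd_perm t = odd_perm s].
Proof.
elim: {D}_.+1 {-2}D s (ltnSn #|D|) => // m IH D s; rewrite ltnS => Dm ws Ds.
have [->|[c cD]] := set_0Vmem D; first by exists s; rewrite finset.setD0.
have cs : c \in long_even_cycles s by exact: (fintype.subsetP Ds).
have [s1 [s2 [s12 _ l1 _ [sg1 _]]]] := perm_point_split R cs.
have [w1 _] := minimizes_avg ws s12.
have [||t [wt lt ot]] := IH (D :\ c) s1 _ w1.
- by move: Dm; rewrite (cardsD1 c) cD; lia.
- by rewrite l1 finset.setSD.
exists t; split=> //.
  rewrite lt l1; apply/setP => d; rewrite !inE; case: (eqVneq d c) => //= ->.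
  by rewrite cD.
move=> h; rewrite ot => [|d]; last by rewrite !inE => /andP[_]; exact: h.
by rewrite sg1 (negPf (h c cD)) addbF.
Qed.

Definition mixed_face w := exists s t,
  [/\ minimizes w s, minimizes w t, ~~ odd_perm s & odd_perm t].

Lemma mixed_faceP w s t : minimizes w s -> minimizes w t ->
  odd_perm s != odd_perm t -> mixed_face w.
Proof.
move=> ws wt; case: (boolP (odd_perm s)) => so; case: (boolP (odd_perm t)) => tt // _.
  by exists t, s.
by exists s, t.
Qed.

(* If no minimizer has a cycle of length divisible by 4, then splitting all long
   even cycles preserves the signs. *)
Lemma mixed_face_cases w : mixed_face w ->
  (exists s c, [/\ minimizes w s, long_even_cycles s = [set c]%SET & (4 %| #|c|)%N])
  \/
  (exists a b, [/\ minimizes w a, minimizes w b, odd_perm a != odd_perm b,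
     long_even_cycles a = finset.set0 & long_even_cycles b = finset.set0]).
Proof.
move=> [s [t [ws wt so to]]].
have split u : minimizes w u ->
    (exists s c, [/\ minimizes w s, long_even_cycles s = [set c]%SET & (4 %| #|c|)%N])
    \/ (exists a, [/\ minimizes w a, odd_perm a = odd_perm u &
          long_even_cycles a = finset.set0]).
  move=> wu; have [/existsP[c /andP[cu c4]]|/existsPn h] :=
      boolP [exists c, (c \in long_even_cycles u) && (4 %| #|c|)%N].
    have [a [wa la _]] := split_cycles wu (finset.subD1set (long_even_cycles u) c).
    left; exists a, c; split=> //; rewrite la; apply/setP => d; rewrite !inE.
    by case: (eqVneq d c) => [->|]/=; [move: cu; rewrite !inE|rewrite andNb].
  have [a [wa la oa]] := split_cycles wu (subxx (long_even_cycles u)).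
  right; exists a; split=> //; last by rewrite la finset.setDv.
  by apply: oa => c cu; have := h c; rewrite cu.
have [?|[a [wa oa la]]] := split s ws; first by left.
have [?|[b [wb ob lb]]] := split t wt; first by left.
by right; exists a, b; split; rewrite // oa ob (negPf so) to.
Qed.

Lemma cycle_edge w s c : minimizes w s -> long_even_cycles s = [set c]%SET ->
  (4 %| #|c|)%N -> exists a b, [/\ is_edge P (pt a) (pt b), minimizes w a,
    minimizes w b, odd_perm a != odd_perm s & segment (pt a) (pt b) (pt s)].
Proof.
move=> ws sc c4; have cs : c \in long_even_cycles s by rewrite sc finset.in_set1.
have [s1 [s2 [s12 s1s _ _ [sg1 _]]]] := perm_point_split R cs.
have [w1 w2] := minimizes_avg ws s12.
have face_s := off_support_edge sc s12 s1s.
exists s1, s2; split=> //; last 2 first.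
- by rewrite sg1 c4 addbT; case: odd_perm.
- rewrite -face_s; split; first exact: polytope_perm.
  by move=> y Py; apply: minimizes_polytope => //; exact: off_support_min.
split; last by exists (off_support R s).
apply: contraNneq s1s => s1s2; apply/eqP/rowP => k.
have := congr1 (fun v : 'rV_ _ => v 0 k) s12; rewrite -s1s2 !mxE; lra.
Qed.

Definition is_vertex s := exists z : 'rV[R]_(symdim n), forall t,
  dot z (pt s) <= dot z (pt t) /\ (dot z (pt t) = dot z (pt s) -> pt t = pt s).

Lemma long_even_cycles_vertex s : long_even_cycles s = finset.set0 -> is_vertex s.
Proof.
move=> l0; exists (off_support R s) => t; split; first exact: off_support_min.
by rewrite off_support_self; exact: off_support_vertex.
Qed.

(* One step of the simplex algorithm: among the directions out of [a], seen in
   the slice [dot z _ = 1] of the tangent cone, one that minimizes [eta] is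
   extreme if ties are broken in favour of the point furthest from the origin. *)
Lemma simplex_step w a b (eta : 'rV[R]_(symdim n)) : minimizes w a ->
  minimizes w b -> is_vertex a -> dot eta (pt b) < dot eta (pt a) ->
  exists e, [/\ minimizes w e, is_vertex e, dot eta (pt e) < dot eta (pt a) &
    is_edge P (pt a) (pt e)].
Proof.
move=> wa wb [z za] eta_ab.
(* [h] is the height above [pt a] with respect to [z], and [y s] is the direction from [pt a] to
   [pt s] scaled to height 1. *)
pose h s := dot z (pt s) - dot z (pt a).
pose y s := (h s)^-1 *: (pt s - pt a).
pose dir s := minimizes w s /\ pt s != pt a.
have h_gt0 s : pt s != pt a -> 0 < h s.
  move=> sa; rewrite subr_gt0 lt_neqAle (za s).1 andbT eq_sym.
  by apply: contraNneq sa => /(za s).2 ->.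
have yE s : pt s != pt a -> pt s - pt a = h s *: y s.
  by move=> sa; rewrite scalerA divff ?scale1r// gt_eqF ?h_gt0.
have zy s : pt s != pt a -> dot z (y s) = 1.
  by move=> sa; rewrite dotZr dotBr mulVf// gt_eqF ?h_gt0.
have ba : pt b != pt a by apply/eqP => ba; rewrite ba ltxx in eta_ab.
have [|s0 [Is0 s0min]] := @finite_argmin _ _ dir (fun s => dot eta (y s)); first by exists b.
have [|s1 [[Is1 s1s0] s1max]] := @finite_argmin _ _
    (fun s => dir s /\ dot eta (y s) = dot eta (y s0)) (fun s => - dot (y s) (y s)).
  by exists s0.
(* Since [y s1] has maximal norm among the ties, [- dot (y s1) (y s)] is smallest there at [y s1]
   alone, so a small multiple of it singles out this direction. *)
have [||d [d0 /(_ d d0 (lexx d)) dP]] := @lexicographic_min _ _ dir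
    (fun s => dot eta (y s)) (fun s => - dot (y s1) (y s)) s1.
- by move=> s Is; rewrite s1s0 s0min.
- move=> s Is; rewrite s1s0 => ss; have := s1max s (conj Is ss).
  have := dot_ge0 (y s1 - y s); rewrite dotBl !dotBr (dotC (y s)); lra.
pose eta' := eta - d *: y s1.
have eta'E s : dot eta' (y s) = dot eta (y s) + d * - dot (y s1) (y s).
  by rewrite dotBl dotZl mulrN.
(* Subtracting this multiple of [z] makes the functional vanish along [y s1] and nonnegative along
   the other directions in the face of [w]. *)
pose theta := eta' - dot eta' (y s1) *: z.
have thetaE s : pt s != pt a ->
    dot theta (pt s) - dot theta (pt a) = h s * (dot eta' (y s) - dot eta' (y s1)).
  by move=> sa; rewrite -dotBr yE// dotZr dotBl dotZl zy// mulr1.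
have theta_min s : minimizes w s -> dot theta (pt a) <= dot theta (pt s).
  move=> ws; have [->//|sa] := eqVneq (pt s) (pt a).
  rewrite -subr_ge0 thetaE//; apply: mulr_ge0; first by rewrite ltW ?h_gt0.
  rewrite subr_ge0 !eta'E.
  by apply: (dP _ _).1.
have theta_eq s : minimizes w s -> pt s != pt a ->
    dot theta (pt s) = dot theta (pt a) -> y s = y s1.
  move=> ws sa /eqP; rewrite -subr_eq0 thetaE// mulf_eq0 gt_eqF ?h_gt0//= subr_eq0.
  rewrite !eta'E => /eqP/(dP s (conj ws sa)).2[ss1 /oppr_inj ys].
  have := s1max s (conj (conj ws sa) _); rewrite ss1 s1s0 => /(_ erefl) le.
  apply/eqP; rewrite -subr_eq0; apply/eqP/dot_eq0/le_anti.
  rewrite dot_ge0 andbT dotBl !dotBr (dotC (y s)) ys; lra.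
(* Several points may lie on the ray along [y s1]; the highest one is the far end of the edge. *)
have [|e [[Ie ye] emax]] := @finite_argmin _ _
    (fun s => dir s /\ y s = y s1) (fun s => - h s); first by exists s1.
have [we ea] := Ie.
have theta_e : dot theta (pt e) = dot theta (pt a).
  by apply/eqP; rewrite -subr_eq0 thetaE// ye subrr mulr0.
have [||d2 [d20 /(_ d2 d20 (lexx d2)) d2P]] := @lexicographic_min _ _ (fun=> True)
    (fun s => dot w (pt s)) (fun s => dot theta (pt s)) a.
- by move=> s _; exact: wa.
- by move=> s _ /(minimizes_eq wa) /theta_min.
pose omega := w + d2 *: theta.
have omegaE s : dot omega (pt s) = dot w (pt s) + d2 * dot theta (pt s).
  by rewrite dotDl dotZl.
have omega_a : minimizes omega a by move=> s; rewrite !omegaE; exact: (d2P s _).1.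
have omega_e : dot omega (pt e) = dot omega (pt a).
  by rewrite !omegaE theta_e (minimizes_dot we wa).
have omega_eq s : dot omega (pt s) = dot omega (pt a) -> pt s != pt a ->
    minimizes w s /\ y s = y s1.
  rewrite !omegaE => /(d2P s I).2[ws ts] sa.
  by have ws' := minimizes_eq wa ws; split=> //; exact: theta_eq.
exists e; split=> //.
- have [||d3 [d30 /(_ d3 d30 (lexx d3)) d3P]] := @lexicographic_min _ _ (fun=> True)
    (fun s => dot omega (pt s)) (fun s => - h s) e.
  + by move=> s _; rewrite omega_e; exact: omega_a.
  + move=> s _; rewrite omega_e => sa; have [sa'|sa'] := eqVneq (pt s) (pt a).
      by rewrite /h sa' subrr oppr0 oppr_le0 ltW ?h_gt0.
    by have [ws ys] := omega_eq _ sa sa'; apply: emax; split.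
  (* Tilting [omega] slightly against [z] selects the highest point of the edge, which shows that
     [e] is a vertex. *)
  exists (omega - d3 *: z) => s.
  have E u : dot (omega - d3 *: z) (pt u) = dot omega (pt u) + d3 * - h u - d3 * dot z (pt a).
    by rewrite dotBl dotZl /h; ring.
  rewrite !E; split; first by rewrite lerD2r; exact: (d3P s _).1.
  move=> /addIr/(d3P s I).2[]; rewrite omega_e => sa /oppr_inj hs.
  have sa' : pt s != pt a.
    by apply: contraTneq (h_gt0 _ ea) => sa'; rewrite -hs /h sa' subrr ltxx.
  have [_ ys] := omega_eq _ sa sa'; apply: (@addIr _ (- pt a)).
  by rewrite !yE// hs ys ye.
- rewrite -subr_lt0 -dotBr yE// dotZr pmulr_rlt0 ?h_gt0// ye s1s0.
  apply: le_lt_trans (s0min b _) _ => //.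
  by rewrite dotZr pmulr_rlt0 ?invr_gt0 ?h_gt0// dotBr subr_lt0.
split; first by rewrite eq_sym.
exists omega; apply: face_segment => // s sa.
have [->|sa'] := eqVneq (pt s) (pt a); first exact: segment_l.
have [ws ys] := omega_eq _ sa sa'.
exists (h s / h e).
  have := emax s (conj (conj ws sa') ys); rewrite lerN2 => hse.
  by apply/andP; rewrite ler_pdivrMr ?mul1r ?h_gt0// divr_ge0// ltW ?h_gt0.
have -> : (1 - h s / h e) *: pt a + (h s / h e) *: pt e =
    pt a + (h s / h e) *: (pt e - pt a).
  by apply/rowP => k; rewrite !mxE; ring.
rewrite yE// scalerA divfK ?gt_eqF ?h_gt0// ye -ys -yE//.
by rewrite addrC subrK.
Qed.

(** Let [eta] expose [b], and let [a] minimize [eta] among the minimizing vertices with the sign of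
    [a0]. A simplex step from [a] lowers [eta] further and so reaches the opposite sign. *)
Lemma vertex_edge w a0 b : minimizes w a0 -> minimizes w b -> is_vertex a0 ->
  is_vertex b -> odd_perm a0 != odd_perm b -> exists a e,
    [/\ is_edge P (pt a) (pt e), minimizes w a, minimizes w e &
        odd_perm a != odd_perm e].
Proof.
move=> wa0 wb va0 [eta etaP] ob.
have [|a [[wa va oa] amin]] := @finite_argmin R _
    (fun s => [/\ minimizes w s, is_vertex s & odd_perm s = odd_perm a0])
    (fun s => dot eta (pt s)); first by exists a0.
have ba : dot eta (pt b) < dot eta (pt a).
  rewrite lt_neqAle (etaP a).1 andbT eq_sym; apply: contraNneq ob => /(etaP a).2.
  by move=> /exponent_vector_inj/odd_perm_monomial <-; rewrite oa.
have [e [we ve ea edge_ae]] := simplex_step wa wb va ba.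
exists a, e; split=> //; apply: contraTneq ea => ae; rewrite -leNgt amin//.
by split=> //; rewrite -ae.
Qed.

Lemma mixed_face_edge w : mixed_face w -> exists a b,
  [/\ is_edge P (pt a) (pt b), minimizes w a, minimizes w b &
      has_both_signs_perm (segment (pt a) (pt b))].
Proof.
move=> /mixed_face_cases[[s [c [ws sc c4]]]|[a0 [b0 [wa wb oab la lb]]]].
  have [a [b [eab wa wb oa seg]]] := cycle_edge ws sc c4.
  exists a, b; split=> //; have seg_a := segment_l (pt a) (pt b).
  move: oa; case: (boolP (odd_perm s)) => so; case: (boolP (odd_perm a)) => ao // _.
    by exists a, s.
  by exists s, a.
have [a [b [eab wa' wb' oab']]] := vertex_edge wa wb
  (long_even_cycles_vertex la) (long_even_cycles_vertex lb) oab.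
exists a, b; split=> //; have sa := segment_l (pt a) (pt b).
have sb := segment_r (pt a) (pt b); move: oab'.
case: (boolP (odd_perm a)) => ao; case: (boolP (odd_perm b)) => bo // _.
  by exists b, a.
by exists a, b.
Qed.

End MixedEdges.

(** * The tropicalization *)

Section DeterminantExpansion.
Variable n : nat.
Implicit Types (s t : 'S_n) (k : 'I_(symdim n)).

Lemma prod_perm_monomial (S : comPzRingType) (x : 'I_(symdim n) -> S) s :
  \prod_i x (symvar i (s i)) = \prod_k x k ^+ perm_monomial s k.
Proof.
under [RHS]eq_bigr => k _ do rewrite perm_monomialE expr_sum.
rewrite exchange_big; apply: eq_bigr => i _ /=.
rewrite (bigD1 (symvar i (s i)))//= eqxx expr1 big1 ?mulr1// => k.
by rewrite eq_sym => /negPf ->.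
Qed.

(** With [Q] the set of minimizers of a weight, this is the initial form of the determinant. *)
Definition partial_det (S : comPzRingType) (Q : pred 'S_n) (x : 'I_(symdim n) -> S) :=
  \sum_(s | Q s) (-1) ^+ s * \prod_k x k ^+ perm_monomial s k.

Definition partial_det_coef (S : comPzRingType) (Q : pred 'S_n)
    (x : 'I_(symdim n) -> S) k0 (j : nat) :=
  \sum_(s | Q s && (perm_monomial s k0 == j))
    (-1) ^+ s * \prod_(k | k != k0) x k ^+ perm_monomial s k.

Lemma det_sym_mx (S : comNzRingType) (x : 'rV[S]_(symdim n)) :
  \det (sym_mx x) = partial_det xpredT (x 0).
Proof.
apply: eq_bigr => s _; congr (_ * _); rewrite -prod_perm_monomial.
by apply: eq_bigr => i _; rewrite mxE.
Qed.

Lemma partial_detE (S : comPzRingType) (Q : pred 'S_n) (x : 'I_(symdim n) -> S) k0 :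
  partial_det Q x = partial_det_coef Q x k0 2 * x k0 ^+ 2 +
    partial_det_coef Q x k0 1 * x k0 + partial_det_coef Q x k0 0.
Proof.
have E j : partial_det_coef Q x k0 j * x k0 ^+ j =
    \sum_(s | Q s && (perm_monomial s k0 == j))
      (-1) ^+ s * \prod_k x k ^+ perm_monomial s k.
  rewrite big_distrl; apply: eq_bigr => s /andP[_ /eqP sj] /=.
  by rewrite [in RHS](bigD1 k0)//= sj -mulrA; congr (_ * _); rewrite mulrC.
rewrite -[X in _ + _ * X + _]expr1 -[partial_det_coef Q x k0 0]mulr1 -(expr0 (x k0)).
rewrite !E /partial_det (bigID (fun s => perm_monomial s k0 == 2%N))/= -addrA; congr (_ + _).
rewrite (bigID (fun s => perm_monomial s k0 == 1%N))/=; congr (_ + _); apply: eq_bigl => s.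
  by case: (Q s) => //=; case: eqP => // ->.
  by case: (Q s) => //=; have := perm_monomial_le2 s k0; lia.
Qed.

Lemma eq_partial_det_coef (S : comPzRingType) (Q : pred 'S_n)
    (x y : 'I_(symdim n) -> S) k0 j :
  (forall k, k != k0 -> x k = y k) ->
  partial_det_coef Q x k0 j = partial_det_coef Q y k0 j.
Proof.
move=> xy; apply: eq_bigr => s _; congr (_ * _).
by apply: eq_bigr => k /xy ->.
Qed.

Lemma rmorph_partial_det_coef (S S' : comNzRingType) (f : {rmorphism S -> S'})
    (Q : pred 'S_n) (x : 'I_(symdim n) -> S) k0 j :
  f (partial_det_coef Q x k0 j) = partial_det_coef Q (f \o x) k0 j.
Proof.
rewrite rmorph_sum; apply: eq_bigr => s _.
rewrite rmorphM rmorph_sign rmorph_prod; congr (_ * _).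
by apply: eq_bigr => k _; rewrite rmorphXn.
Qed.

Definition rat_cost (q : 'I_(symdim n) -> rat) s : rat :=
  \sum_k q k *+ perm_monomial s k.

Section Leading.
Variables (K : fieldType) (x : 'I_(symdim n) -> puiseux K)
  (q : 'I_(symdim n) -> rat) (c : 'I_(symdim n) -> K) (e : rat).
Hypothesis e_min : forall s, e <= rat_cost q s.
Let Q s := rat_cost q s == e.

Lemma lead_sign_mul s (f : puiseux K) r (d : K) :
  lead f r d -> lead ((-1) ^+ s * f) r ((-1) ^+ s * d).
Proof. by move=> fr; rewrite !mulr_sign; case: (odd_perm s) => //; exact: leadN. Qed.

Lemma lead_partial_det : (forall k, lead (x k) (q k) (c k)) ->
  lead (partial_det xpredT x) e (partial_det Q c).
Proof.
move=> xq; rewrite [partial_det Q c]big_mkcond; apply: lead_sum => s _ /=.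
have h : lead (\prod_k x k ^+ perm_monomial s k) (rat_cost q s)
    (\prod_k c k ^+ perm_monomial s k).
  by apply: lead_prod => k _; exact: leadX.
rewrite /Q; case: eqP => [<-|/eqP es]; first exact: lead_sign_mul.
apply: lead_weaken (lead_sign_mul s h).
by rewrite lt_neqAle eq_sym es e_min.
Qed.

Lemma lead_partial_det_coef k0 j : (forall k, k != k0 -> lead (x k) (q k) (c k)) ->
  lead (partial_det_coef xpredT x k0 j) (e - q k0 *+ j) (partial_det_coef Q c k0 j).
Proof.
move=> xq; rewrite /partial_det_coef [X in lead _ _ X]big_mkcond [X in lead X _ _]big_mkcond.
apply: lead_sum => s _ /=; rewrite [Q s && _]andbC; case: eqP => [sj|_]//=.
have h : lead (\prod_(k | k != k0) x k ^+ perm_monomial s k) (rat_cost q s - q k0 *+ j)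
    (\prod_(k | k != k0) c k ^+ perm_monomial s k).
  rewrite /rat_cost [X in X - _](bigD1 k0)//= sj addrAC subrr add0r.
  by apply: lead_prod => k kk0; apply: leadX; exact: xq.
rewrite /Q; case: eqP => [<-|/eqP es]; first exact: lead_sign_mul.
apply: lead_weaken (lead_sign_mul s h).
by rewrite ltrD2r lt_neqAle eq_sym es e_min.
Qed.

End Leading.

End DeterminantExpansion.

Section Tropicalization.
Variables (R : realType) (n : nat).
Implicit Types (s t a b : 'S_n) (k : 'I_(symdim n)) (w x y : 'rV[R]_(symdim n))
  (q : 'I_(symdim n) -> rat) (c : 'I_(symdim n) -> R).
Local Notation pt := (perm_point R).

Lemma dot_rat_cost q s : dot (\row_k ratr (q k)) (pt s) = ratr (rat_cost q s).
Proof.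
rewrite rmorph_sum; apply: eq_bigr => k _.
by rewrite !mxE rmorphMn /= mulr_natr.
Qed.

Lemma singular_mixed_face (x : 'rV[puiseux R[i]]_(symdim n)) :
  singular_symmetric R n x -> (forall k, Cplus (x 0 k)) -> mixed_face (val_point x).
Proof.
move=> x_sing xpos; pose q k := pval (x 0 k).
have [|s0 [_ s0min]] := @finite_argmin R _ (fun=> True) (fun s => dot (val_point x) (pt s)).
  by exists 1%g.
have s0m : minimizes (val_point x) s0 by move=> t; exact: s0min.
have emin s : rat_cost q s0 <= rat_cost q s.
  by rewrite -(ler_rat R) -!dot_rat_cost; exact: s0m.
have xq k : lead (x 0 k) (q k) (x 0 k (q k)) by apply: lead_pval; exact: (xpos k).1.
have := lead_partial_det emin xq; rewrite -det_sym_mx x_sing => -[_ /esym G0].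
have prod_gt0 s : 0 < \prod_k x 0 k (q k) ^+ perm_monomial s k.
  by apply: prodr_gt0 => k _; rewrite exprn_gt0//; exact: (xpos k).2.
have min_s s : rat_cost q s == rat_cost q s0 -> minimizes (val_point x) s.
  by move=> /eqP ss0; apply: (minimizes_eq s0m); rewrite [LHS]dot_rat_cost [RHS]dot_rat_cost ss0.
(* If all minimizers had the sign of [s0], the vanishing coefficient of lowest order would be, up to
   sign, a sum of positive terms. *)
have [s [so sm]] : exists s, odd_perm s != odd_perm s0 /\ rat_cost q s == rat_cost q s0.
  apply: contrapT => /forallNP h.
  have G0' : \sum_(s | rat_cost q s == rat_cost q s0)
      \prod_k x 0 k (q k) ^+ perm_monomial s k = 0.
    apply: (mulfI (_ : (-1) ^+ s0 != 0)); first by rewrite signr_eq0.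
    rewrite mulr0 -[RHS]/((0 : puiseux R[i]) (rat_cost q s0)) -G0 big_distrr.
    apply: eq_bigr => s ss0 /=; congr (_ * _).
    by have := h s; rewrite ss0; case: eqP => [->|]// _ [].
  have : \prod_k x 0 k (q k) ^+ perm_monomial s0 k <= 0.
    rewrite -[leRHS]G0' (bigD1 s0)//= lerDl sumr_ge0// => s _.
    exact/ltW/prod_gt0.
  by rewrite (lt_geF (prod_gt0 s0)).
exact: mixed_faceP (min_s _ sm) s0m so.
Qed.

Lemma dot_continuous y : continuous (fun w : 'rV[R]_(symdim n) => dot w y).
Proof.
rewrite /dot; elim: (index_enum _) => [|k r IH].
  have -> : (fun v : 'rV[R]_(symdim n) => \sum_(k <- [::]) v 0 k * y 0 k) = fun=> 0.
    by apply/funext => v; rewrite big_nil.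
  exact: cst_continuous.
have -> : (fun v : 'rV[R]_(symdim n) => \sum_(j <- k :: r) v 0 j * y 0 j) =
    (fun v : 'rV[R]_(symdim n) => v 0 k * y 0 k) +
    (fun v : 'rV[R]_(symdim n) => \sum_(j <- r) v 0 j * y 0 j).
  by apply/funext => v; rewrite big_cons.
move=> w; apply: continuousD; last exact: IH.
apply: (@continuous_comp _ _ _ (fun v : 'rV[R]_(symdim n) => v 0 k) ( *%R^~ (y 0 k))).
  exact: coord_continuous.
exact: mulrr_continuous.
Qed.

(** The tropicalization is a closure, so the set that bounds it must be closed. It is a finite union
    of intersections of half-spaces. *)
Lemma mixed_face_closed : closed [set w : 'rV[R]_(symdim n) | mixed_face w].
Proof.
have -> : [set w : 'rV[R]_(symdim n) | mixed_face w] =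
    \bigcup_(st in [set st : 'S_n * 'S_n | ~~ odd_perm st.1 && odd_perm st.2])
    \bigcap_t [set w | dot w (pt st.1) <= dot w (pt t) /\ dot w (pt st.2) <= dot w (pt t)].
  apply/seteqP; split=> [w [s [t [ws wt so to]]]|w [[s t] /= /andP[so to] h]].
    by exists (s, t) => /=; [rewrite so|move=> u _; split; [exact: ws|exact: wt]].
  by exists s, t; split=> // u; [exact: (h u I).1|exact: (h u I).2].
apply: closed_bigcup => [|[s t] _]; first exact: finite_finset.
apply: closed_bigI => u _ /=.
have half a b : closed [set w : 'rV[R]_(symdim n) | dot w (pt a) <= dot w (pt b)].
  rewrite (_ : mkset _ = (fun w => dot w (pt b - pt a)) @^-1` [set r : R | 0 <= r]).
    by have /continuous_closedP := @dot_continuous (pt b - pt a); apply; exact: closed_ge.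
  by apply/funext => w; rewrite /= dotBr subr_ge0.
exact: closedI (half s u) (half t u).
Qed.

Lemma trop_mixed_face w :
  trop_Cplus (singular_symmetric R n) w -> mixed_face w.
Proof.
move: w; rewrite /trop_Cplus closureE; apply: smallest_sub; first exact: mixed_face_closed.
by move=> _ [x [x_sing xpos] <-]; exact: singular_mixed_face.
Qed.

End Tropicalization.

(** * Lifting mixed weights to singular matrices *)

Section Lifting.
Variables (R : realType) (n : nat).
Implicit Types (s t a b : 'S_n) (k : 'I_(symdim n)) (w x y z : 'rV[R]_(symdim n))
  (q : 'I_(symdim n) -> rat) (c : 'I_(symdim n) -> R).
Local Notation pt := (perm_point R).

Lemma dot_perm_bound y s (e : R) : (forall k, `|y 0 k| <= e) ->
  `|dot y (pt s)| <= (symdim n)%:R * (e * 2).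
Proof.
move=> ye; apply: le_trans (ler_norm_sum _ _ _) _.
have -> : (symdim n)%:R * (e * 2) = \sum_(k < symdim n) e * 2.
  by rewrite sumr_const card_ord mulr_natl.
apply: ler_sum => k _; rewrite normrM mxE; apply: ler_pM => //.
by rewrite ger0_norm// ler_nat perm_monomial_le2.
Qed.

(** Rounding the coefficients [u], and not the vector [u *m map_mx ratr K] itself, keeps the
    approximation in the row space of [K]. *)
Lemma rational_near (m p : nat) (K : 'M[rat]_(m, p)) (u : 'rV[R]_m) (e : R) : 0 < e ->
  exists v : 'rV[rat]_m, forall k : 'I_p,
    `|ratr ((v *m K) 0 k) - (u *m map_mx ratr K) 0 k| < e.
Proof.
move=> e0; pose S : R := \sum_j \sum_k `|ratr (K j k)|.
have S0 : 0 <= S by apply: sumr_ge0 => j _; apply: sumr_ge0.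
have S1 : 0 < S + 1 by rewrite ltr_wpDl.
pose d := e / (S + 1); have d0 : 0 < d by rewrite divr_gt0.
have /choice[v vP] (j : 'I_m) : exists r : rat, `|ratr r - u 0 j| <= d.
  have [|r] := @rat_in_itvoo R (u 0 j - d) (u 0 j + d); first by lra.
  by rewrite in_itv /= => /andP[r1 r2]; exists r; rewrite ler_norml; lra.
exists (\row_j v j) => k.
rewrite !mxE rmorph_sum -sumrB /=.
apply: (@le_lt_trans _ _ (d * S)); last first.
  by rewrite /d mulrAC ltr_pdivrMr// ltr_pM2l// ltrDl.
apply: le_trans (ler_norm_sum _ _ _) _; rewrite mulr_sumr.
apply: ler_sum => j _; rewrite !mxE rmorphM -mulrBl normrM.
apply: ler_pM => //; first exact: vP.
by rewrite (bigD1 k)//= lerDl sumr_ge0.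
Qed.

(* The equations between costs have rational coefficients, hence a rational
   basis of solutions; the inequalities are open. *)
Lemma rational_approximation w (e : R) : 0 < e -> exists q,
  (forall k, `|ratr (q k) - w 0 k| < e) /\
  forall s t, (dot w (pt s) = dot w (pt t) -> rat_cost q s = rat_cost q t) /\
              (dot w (pt s) < dot w (pt t) -> rat_cost q s < rat_cost q t).
Proof.
move=> e0; pose N := symdim n.
pose eqw (st : 'S_n * 'S_n) := dot w (pt st.1) == dot w (pt st.2).
pose diff (st : 'S_n * 'S_n) k : rat :=
  (perm_monomial st.1 k)%:R - (perm_monomial st.2 k)%:R.
pose M : 'M[rat]_(N, #|{: 'S_n * 'S_n}|) :=
  \matrix_(k, j) (if eqw (enum_val j) then diff (enum_val j) k else 0).
have dotB (st : 'S_n * 'S_n) :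
    dot w (pt st.1) - dot w (pt st.2) = \sum_k w 0 k * ratr (diff st k).
  by rewrite -dotBr; apply: eq_bigr => k _; rewrite !mxE /diff rmorphB /= !ratr_nat.
have wM : w *m map_mx ratr M = 0.
  apply/rowP => j; rewrite !mxE; case: (boolP (eqw (enum_val j))) => ej; last first.
    by apply: big1 => k _; rewrite !mxE (negPf ej) rmorph0 mulr0.
  move: (ej); rewrite /eqw -subr_eq0 dotB => /eqP e1; rewrite -[RHS]e1.
  by apply: eq_bigr => k _; rewrite !mxE ej.
have /sub_kermxP/submxP[u wu] := wM; rewrite -map_kermx in wu.
(* Each cost moves by at most [2 N d], so a gap larger than [4 N d] survives; the summand 1 in the
   denominator makes the comparison strict. *)
pose h (st : 'S_n * 'S_n) := if dot w (pt st.1) < dot w (pt st.2) then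
  (dot w (pt st.2) - dot w (pt st.1)) / (4 * N%:R + 1) else 1.
have N0 : 0 < 4 * N%:R + 1 :> R by rewrite ltr_wpDl// mulr_ge0.
have [|d [d0 dh]] := @finite_lower_bound _ _ h.
  by move=> st; rewrite /h; case: ifP => // ?; rewrite divr_gt0// subr_gt0.
have [|v vP] := @rational_near _ _ (kermx M) u (Num.min e d).
  by rewrite lt_min e0 d0.
exists (fun k => (v *m kermx M) 0 k); split=> [k|s t].
  by have := vP k; rewrite -wu lt_min => /andP[].
have costB : rat_cost (fun k => (v *m kermx M) 0 k) s -
    rat_cost (fun k => (v *m kermx M) 0 k) t =
    \sum_k (v *m kermx M) 0 k * diff (s, t) k.
  by rewrite -sumrB; apply: eq_bigr => k _; rewrite mulrBr !mulr_natr.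
split=> [/eqP st|st].
  apply/eqP; rewrite -subr_eq0 costB; apply/eqP.
  have : (v *m kermx M) *m M = 0 by rewrite -mulmxA mulmx_ker mulmx0.
  move=> /rowP/(_ (enum_rank (s, t))); rewrite mxE [in RHS]mxE => h0; rewrite -[RHS]h0.
  by apply: eq_bigr => k _; rewrite [M _ _]mxE enum_rankK /eqw st.
rewrite -(ltr_rat R) -!dot_rat_cost.
set p := \row_k ratr _; have pw k : `|(p - w) 0 k| <= d.
  by have := vP k; rewrite -wu !mxE lt_min => /andP[_ /ltW].
have := dot_perm_bound s pw; have := dot_perm_bound t pw.
have := dh (s, t); rewrite /h/= st ler_pdivlMr// !dotBl => d1.
by rewrite !ler_norml => /andP[d2 d3] /andP[d4 d5]; nra.
Qed.

(** At the point [exp (- M z)], with [z] exposing [a] and [M] large, the monomial of [a] outweighs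
    all others together. *)
Lemma dominant_vertex a (Q : pred 'S_n) : Q a -> is_vertex R a ->
  exists c, (forall k, 0 < c k) /\ 0 < (-1) ^+ a * partial_det Q c.
Proof.
move=> Qa [z za].
pose h s := if pt s == pt a then 1 else dot z (pt s) - dot z (pt a).
have [|d [d0 dh]] := @finite_lower_bound _ _ h.
  move=> s; rewrite /h; case: ifPn => // sa; rewrite subr_gt0 lt_neqAle (za s).1.
  by rewrite andbT; apply: contraNneq sa => /esym/(za s).2 ->.
(* With this [M] a term with another monomial is at most [1 / (C + 1)] of the term of [a], and there
   are at most [C] such terms. *)
pose C : R := #|{: 'S_n}|%:R; pose M := C / d.
have C0 : 0 <= C by [].
have M0 : 0 <= M by rewrite divr_ge0// ltW.
pose c k := expR (- M * z 0 k).
have cE s : \prod_k c k ^+ perm_monomial s k = expR (- M * dot z (pt s)).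
  rewrite mulr_sumr expR_sum; apply: eq_bigr => k _.
  by rewrite -expRM_natr mxE mulrA.
exists c; split=> [k|]; first exact: expR_gt0.
rewrite big_distrr /=; under eq_bigr => s _ do rewrite cE mulrA -signr_addb.
have term s : Q s -> - (expR (- M * dot z (pt a)) * (C + 1)^-1) <=
    (-1) ^+ (odd_perm a (+) odd_perm s) * expR (- M * dot z (pt s)).
  move=> _; have [/exponent_vector_inj/odd_perm_monomial ->|sa] := eqVneq (pt s) (pt a).
    rewrite addbb mul1r (le_trans _ (expR_ge0 _))// oppr_le0 mulr_ge0 ?expR_ge0//.
    by rewrite invr_ge0 addr_ge0.
  have : expR (- M * dot z (pt s)) <= expR (- M * dot z (pt a)) * (C + 1)^-1.
    rewrite ler_pdivlMr ?ltr_wpDl//.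
    have -> : - M * dot z (pt a) = - M * dot z (pt s) + M * (dot z (pt s) - dot z (pt a)) by ring.
    rewrite expRD ler_pM2l ?expR_gt0//; apply: le_trans (expR_ge1Dx _).
    have := dh s; rewrite /h (negPf sa) => /(ler_wpM2l M0).
    by rewrite {1}/M divfK ?gt_eqF// [C + 1]addrC lerD2l.
  have := expR_ge0 (- M * dot z (pt s)).
  by rewrite mulr_sign; case: ifP => _; lra.
rewrite (bigD1 a)//= addbb mul1r -ltrBlDl sub0r.
apply: (@lt_le_trans _ _ (- (expR (- M * dot z (pt a)) * (C + 1)^-1 * C))).
  rewrite ltrN2 -mulrA gtr_pMr ?expR_gt0// mulrC ltr_pdivrMr ?ltr_wpDl//.
  by rewrite mul1r ltrDl.
apply: (@le_trans _ _ (\sum_(s | Q s && (s != a)) - (expR (- M * dot z (pt a)) * (C + 1)^-1))).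
  rewrite sumr_const mulNrn lerN2 -[leLHS]mulr_natr.
  rewrite ler_wpM2l ?ler_nat ?max_card// mulr_ge0 ?expR_ge0// invr_ge0 addr_ge0//.
by apply: ler_sum => s /andP[Qs _]; exact: term.
Qed.

(* Moving from [c0] to [c1] one coordinate at a time, the partial determinant
   is a quadratic polynomial in the coordinate where its sign first changes. *)
Lemma coordinate_root (Q : pred 'S_n) c0 c1 : (forall k, 0 < c0 k) ->
  (forall k, 0 < c1 k) -> partial_det Q c0 != 0 ->
  partial_det Q c0 * partial_det Q c1 <= 0 ->
  exists k0 c, [/\ forall k, 0 < c k, partial_det Q c = 0 &
    exists j, (j <= 2)%N /\ partial_det_coef Q c k0 j != 0].
Proof.
move=> c00 c10 G0 G01; pose N := symdim n.
pose h m (k : 'I_N) := if (k < m)%N then c1 k else c0 k.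
have h_gt0 m k : 0 < h m k by rewrite /h; case: ifP.
pose G m := partial_det Q c0 * partial_det Q (h m).
have ex : exists m, G m <= 0.
  exists N; rewrite /G (_ : h N = c1)//.
  by apply/funext => k; rewrite /h ltn_ord.
have := ex_minnP ex => -[[|m] Gm mmin].
  move: Gm; rewrite /G (_ : h 0%N = c0); last by apply/funext.
  by rewrite -expr2 leNgt lt_neqAle sqr_ge0 eq_sym sqrf_eq0 G0.
have Gm0 : 0 < G m.
  by rewrite ltNge; apply/negP => /mmin; rewrite ltnn.
have mN : (m < N)%N.
  rewrite ltnNge; apply/negP => Nm; suff e : h m.+1 = h m.
    by move: Gm; rewrite /G e leNgt => /negP.
  by apply/funext => k; rewrite /h !(leq_trans (ltn_ord k)) ?leqW.
pose k0 := Ordinal mN; pose hyb (r : R) k := if k == k0 then r else h m k.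
have hyb0 : hyb (c0 k0) = h m.
  by apply/funext => k; rewrite /hyb /h; case: eqP => [->|//]; rewrite ltnn.
have hyb1 : hyb (c1 k0) = h m.+1.
  apply/funext => k; rewrite /hyb /h; case: eqP => [->|/eqP kk0]; first by rewrite ltnS leqnn.
  by rewrite ltnS [in RHS]leq_eqVlt (_ : (k == m :> nat) = false)//; apply/negbTE.
pose A j := partial_det_coef Q (h m) k0 j.
have AE r j : partial_det_coef Q (hyb r) k0 j = A j.
  by apply: eq_partial_det_coef => k /negPf kk0; rewrite /hyb kk0.
pose p : {poly R} := A 2%N *: 'X^2 + A 1%N *: 'X + (A 0%N)%:P.
have pE r : p.[r] = partial_det Q (hyb r).
  by rewrite (partial_detE _ _ k0) !AE /hyb eqxx /p !hornerE.
have pneg : p.[c0 k0] * p.[c1 k0] <= 0.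
  rewrite !pE hyb0 hyb1; have c2 : 0 < partial_det Q c0 ^+ 2.
    by rewrite lt_neqAle sqr_ge0 eq_sym sqrf_eq0 G0.
  rewrite -(pmulr_rle0 _ c2) expr2 mulrACA -/(G m) -/(G m.+1).
  by rewrite pmulr_rle0.
have pc0 : p.[c0 k0] != 0.
  by rewrite pE hyb0; apply: contraTneq Gm0 => e; rewrite /G e mulr0 ltxx.
have [r [r0 pr0]] : exists r, 0 < r /\ p.[r] = 0.
  have [c01|c01] := leP (c0 k0) (c1 k0).
    have [r [+ /rootP pr0]] := polyrcf.poly_ivt c01 pneg.
    by rewrite in_itv => /andP[/= r0 _]; exists r; split=> //; exact: lt_le_trans r0.
  rewrite mulrC in pneg; have [r [+ /rootP pr0]] := polyrcf.poly_ivt (ltW c01) pneg.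
  by rewrite in_itv => /andP[/= r0 _]; exists r; split=> //; exact: lt_le_trans r0.
exists k0, (hyb r); split=> [k||]; first by rewrite /hyb; case: ifP.
- by rewrite -pE.
(* If all three coefficients vanished, [p] would vanish at [c0 k0] too. Lifting the root requires a
   nonzero quadratic. *)
- apply: contrapT => /forallNP h0; move/eqP: pc0; apply; rewrite pE (partial_detE _ _ k0).
  have Aj j : (j <= 2)%N -> A j = 0.
    move=> j2; apply/eqP/negPn/negP => Aj; apply: (h0 j); split=> //.
    by rewrite AE.
  by rewrite !AE !Aj// !mul0r !addr0.
Qed.

(** All coordinates but [k0] are any series with leading terms [c k * t ^ q k]; the coordinate [k0]
    solves the remaining quadratic equation, with leading coefficient [c k0 > 0]. *)
Lemma positive_root_lift q e c0 c1 : (forall s, e <= rat_cost q s) ->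
  (forall k, 0 < c0 k) -> (forall k, 0 < c1 k) ->
  partial_det (fun s => rat_cost q s == e) c0 != 0 ->
  partial_det (fun s => rat_cost q s == e) c0 *
    partial_det (fun s => rat_cost q s == e) c1 <= 0 ->
  exists x : 'rV[puiseux R[i]]_(symdim n), singular_symmetric R n x /\
    forall k, Cplus (x 0 k) /\ pval (x 0 k) = q k.
Proof.
move=> e_min c00 c10 G0 G01; set Q := fun s => rat_cost q s == e in G0 G01.
have [k0 [c [c_gt0 cG [j [j2 cj]]]]] := coordinate_root c00 c10 G0 G01.
pose cC k : R[i] := (c k)%:C%C.
have /choice[X XP] k := monomial_exists (q k) (cC k).
have coefC m : partial_det_coef Q cC k0 m = (partial_det_coef Q c k0 m)%:C%C.
  by rewrite [RHS](rmorph_partial_det_coef (real_complex R)).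
have lead_coef m := lead_partial_det_coef e_min m (fun k (_ : k != k0) => XP k).
have lead2 : lead (partial_det_coef xpredT X k0 2) (e - q k0 - q k0)
    (partial_det_coef Q cC k0 2).
  by have := lead_coef 2%N; rewrite mulr2n opprD addrA.
have lead1 : lead (partial_det_coef xpredT X k0 1) (e - q k0)
    (partial_det_coef Q cC k0 1).
  exact: lead_coef 1%N.
have lead0 : lead (partial_det_coef xpredT X k0 0) e (partial_det_coef Q cC k0 0).
  by have := lead_coef 0%N; rewrite mulr0n subr0.
have real0 (r : R) : (r%:C%C == 0 :> R[i]) = (r == 0) by rewrite -(inj_eq (@complexI R)).
have [||y [y_lead y_root]] := quadratic_lift (s := cC k0) lead2 lead1 lead0.
- rewrite !coefC !real0; apply: contra cj => /and3P[/eqP h2 /eqP h1 /eqP h0].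
  by move: j j2 => [|[|[|]]]// _; rewrite ?h0 ?h1 ?h2.
- by rewrite !coefC -rmorphXn -!rmorphM -!rmorphD -partial_detE cG rmorph0.
pose x : 'rV[puiseux R[i]]_(symdim n) := \row_k (if k == k0 then y else X k).
have x_lead k : lead (x 0 k) (q k) (cC k) by rewrite mxE; case: eqP => [->|].
have cC_gt0 k : 0 < cC k by rewrite ltcR.
exists x; split=> [|k].
  have xX k : k != k0 -> x 0 k = X k by rewrite mxE => /negPf ->.
  rewrite /singular_symmetric /= det_sym_mx (partial_detE _ _ k0).
  by rewrite !(eq_partial_det_coef _ _ xX) mxE eqxx.
have ck0 : cC k != 0 by rewrite gt_eqF.
have xv := pval_lead ck0 (x_lead k); split=> //; split.
  exact: lead_neq0 ck0 (x_lead k).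
by rewrite xv (x_lead k).2.
Qed.

Lemma trop_approximation w :
  (forall e : R, 0 < e -> exists x : 'rV[puiseux R[i]]_(symdim n),
    [/\ singular_symmetric R n x, forall k, Cplus (x 0 k) &
        forall k, `|ratr (pval (x 0 k)) - w 0 k| < e]) ->
  trop_Cplus (singular_symmetric R n) w.
Proof.
move=> h B /nbhs_ballP[e /= e0 eB]; have [x [x_sing xpos xw]] := h e e0.
exists (val_point x); split; first by exists x.
apply: eB; split=> // i k; rewrite (ord1 i) mxE -ball_normE /ball_ /= distrC; exact: xw.
Qed.

(** A nearby rational weight has the same minimizers, and its initial form takes the sign of [a] at
    one positive point and that of [b] at another. *)
Lemma vertices_trop w a b : minimizes w a -> minimizes w b ->
  odd_perm a != odd_perm b -> is_vertex R a -> is_vertex R b ->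
  trop_Cplus (singular_symmetric R n) w.
Proof.
move=> wa wb oab va vb; apply: trop_approximation => e e0.
have [q [qw qP]] := rational_approximation w e0.
have q_min s : rat_cost q a <= rat_cost q s.
  have := wa s; rewrite le_eqVlt => /orP[/eqP/(proj1 (qP a s)) -> //|].
  by move=> /(proj2 (qP a s))/ltW.
have qb : rat_cost q b = rat_cost q a by apply: (qP b a).1; exact: minimizes_dot.
pose Q s := rat_cost q s == rat_cost q a.
have [c0 [c00 G0]] := dominant_vertex (eqxx _ : Q a) va.
have [c1 [c10 G1]] := dominant_vertex (introT eqP qb : Q b) vb.
have [||x [x_sing xP]] := positive_root_lift q_min c00 c10.
- by apply: contraTneq G0 => ->; rewrite mulr0 ltxx.
- move: G0 G1 oab; rewrite !mulr_sign -/Q.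
  case: (odd_perm a); case: (odd_perm b) => // G0 G1 _.
    by rewrite nmulr_rle0 ?ltW// -oppr_gt0.
  by rewrite pmulr_rle0// ltW// -oppr_gt0.
by exists x; split=> // k; [exact: (xP k).1|rewrite (xP k).2].
Qed.

(* The weight [w] is moved into the interior of the normal cone of the edge
   through [s], where the initial form is the determinant of the graph of [s]
   with the coordinates as edge weights. *)
Lemma cycle_trop w s (C : {set 'I_n}) : minimizes w s ->
  long_even_cycles s = [set C]%SET ->
  (4 %| #|C|)%N -> trop_Cplus (singular_symmetric R n) w.
Proof.
move=> ws sc c4; have cs : C \in long_even_cycles s by rewrite sc finset.in_set1.
have [s1 [s2 [s12 s1s l1 _ _]]] := perm_point_split R cs.
have [w1 w2] := minimizes_avg ws s12.
have [z1 _] := minimizes_avg (off_support_min R s) s12.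
have vs1 : is_vertex R s1.
  by apply: long_even_cycles_vertex; rewrite l1 sc finset.setDv.
(* Half of the tolerance is spent on moving [w] to [w'], the other half on the rational
   approximation of [w']. *)
apply: trop_approximation => e e0; pose e2 := e / 2.
have e20 : 0 < e2 by rewrite divr_gt0.
pose w' := w + e2 *: off_support R s.
have w'E t : dot w' (pt t) = dot w (pt t) + e2 * dot (off_support R s) (pt t).
  by rewrite dotDl dotZl.
have w'_min t : dot w' (pt s) <= dot w' (pt t).
  by rewrite !w'E lerD ?ws// ler_pM2l// off_support_min.
have w'_eq t : (dot w' (pt t) = dot w' (pt s)) <-> (dot (off_support R s) (pt t) = 0).
  rewrite !w'E off_support_self mulr0 addr0; split=> [e1|t0].
    have := off_support_ge0 R s t; rewrite le_eqVlt => /orP[/eqP <- //|].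
    move=> /(mulr_gt0 e20); have := ws t; lra.
  have : face (symdet_polytope R n) (off_support R s) (pt t).
    split; first exact: polytope_perm.
    move=> y Py; rewrite t0 -(off_support_self R s).
    exact: minimizes_polytope (off_support_min R s) Py.
  rewrite (off_support_edge sc s12 s1s) => /(dot_segment (minimizes_dot w1 w2)) ->.
  by rewrite t0 mulr0 addr0; exact: minimizes_dot.
have [q [qw qP]] := rational_approximation w' e20.
have q_eq t : (rat_cost q t == rat_cost q s) = (dot (off_support R s) (pt t) == 0).
  apply/eqP/eqP => [qt|/w'_eq]; last exact: (qP t s).1.
  apply/w'_eq/eqP; rewrite eq_le w'_min andbT leNgt.
  by apply/negP => /(proj2 (qP s t)); rewrite qt ltxx.
have q_min t : rat_cost q s <= rat_cost q t.
  have := w'_min t; rewrite le_eqVlt => /orP[/eqP/(proj1 (qP s t)) -> //|].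
  by move=> /(proj2 (qP s t))/ltW.
pose Q t := rat_cost q t == rat_cost q s.
have Qs1 : Q s1.
  by rewrite /Q q_eq -(off_support_self R s) (minimizes_dot z1 (off_support_min R s)).
have [c0 [c00 G0]] := dominant_vertex Qs1 vs1.
(* The initial form is nonzero at [c0] and vanishes at the all-ones point, where it is the
   determinant of the graph of [s]. *)
have [|||x [x_sing xP]] := @positive_root_lift q _ c0 (fun=> 1) q_min c00.
- by [].
- by apply: contraTneq G0 => ->; rewrite mulr0 ltxx.
- suff -> : partial_det Q (fun=> 1 : R) = 0 by rewrite mulr0.
  rewrite -[RHS](det_cycle_graph R cs c4) det_sym_mx /partial_det.
  rewrite big_mkcond; apply: eq_bigr => t _ /=; rewrite /Q q_eq.
  have pt_ge0 k : 0 <= pt t 0 k by rewrite mxE.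
  case: eqP => [/(off_support_eq0 s pt_ge0) t0|t0].
    congr (_ * _); apply: eq_bigr => k _; rewrite mxE.
    case: (eqVneq (perm_monomial s k) 0%N) => // /t0/eqP.
    by rewrite mxE pnatr_eq0 => /eqP ->.
  have [k [sk tk]] : exists k, perm_monomial s k = 0%N /\ perm_monomial t k != 0%N.
    apply: contrapT => /forallNP h; apply/t0/(off_support_eq0 s pt_ge0) => k sk.
    by have := h k; rewrite mxE; case: eqP => [->//|_] [].
  by rewrite (bigD1 k)//= mxE sk eqxx expr0n (negPf tk) mul0r mulr0.
exists x; split=> // k; first exact: (xP k).1.
rewrite (xP k).2; have := qw k; rewrite !mxE !ltr_norml /e2 => /andP[q1 q2].
move: (ratr (q k)) (w 0 k) (perm_monomial s k == 0%N) q1 q2; clear -e0.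
move=> r u b; have := ler0n R b; have := lern1 R b; rewrite leq_b1.
by move=> b1 b0 q1 q2; apply/andP; split; nra.
Qed.

Lemma mixed_face_trop w : mixed_face w -> trop_Cplus (singular_symmetric R n) w.
Proof.
move=> /mixed_face_cases[[s [c [ws sc c4]]]|[a [b [wa wb oab la lb]]]].
  exact: cycle_trop ws sc c4.
by apply: vertices_trop wa wb oab _ _; exact: long_even_cycles_vertex.
Qed.

Lemma trop_mixedE :
  trop_Cplus (singular_symmetric R n) = [set w : 'rV[R]_(symdim n) | mixed_face w].
Proof.
apply/seteqP; split=> w; first exact: trop_mixed_face.
exact: mixed_face_trop.
Qed.

End Lifting.

(** * Lattice points on edges *)

Section LatticePoints.
Variables (R : realType) (n : nat).
Implicit Types (s t u v : 'S_n) (i j : 'I_n) (k : 'I_(symdim n))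
  (x y : 'rV[R]_(symdim n)).
Local Notation pt := (perm_point R).
Local Notation P := (symdet_polytope R n).

Definition transposed s i := (s i != i) && (s (s i) == i).

(** An edge has exponent 2 when it is run through in both directions, that is, by a transposition;
    loops and edges of longer cycles have exponent 1. *)
Lemma odd_perm_monomial_edge s i :
  odd (perm_monomial s (symvar i (s i))) = ~~ transposed s i.
Proof.
suff -> : perm_monomial s (symvar i (s i)) = (transposed s i).+1 by case: transposed.
rewrite perm_monomialE (bigD1 i)//= eqxx add1n; congr _.+1.
have [ti|ti] := boolP (transposed s i).
  have /andP[si /eqP ssi] := ti; rewrite (bigD1 (s i))//= ssi symvarC eqxx.
  rewrite big1 ?addn0// => j /andP[ji jsi]; apply/eqP; rewrite eqb0.
  apply/eqP => /symvar_inj[[jj _]|[jj _]]; first by rewrite jj eqxx in ji.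
  by rewrite jj eqxx in jsi.
apply: big1 => j ji; apply/eqP; rewrite eqb0; apply: contraNN ti.
move=> /eqP/symvar_inj[[jj _]|[jj sj]]; first by rewrite jj eqxx in ji.
by rewrite /transposed -jj ji sj eqxx.
Qed.

Lemma transposed_step s i : transposed s (s i) = transposed s i.
Proof. by rewrite /transposed !(inj_eq perm_inj). Qed.

Lemma card_porbit_transposed s i : transposed s i -> #|porbit s i| = 2%N.
Proof.
move=> /andP[si /eqP ssi]; suff -> : porbit s i = [set i; s i]%SET.
  by rewrite cards2 eq_sym si.
apply/eqP; rewrite finset.eqEsubset; apply/andP; split.
  apply: porbit_min => [|j]; rewrite !inE ?eqxx//.
  by move=> /orP[] /eqP ->; rewrite ?ssi eqxx ?orbT.
by apply/fintype.subsetP => j; rewrite !inE => /orP[] /eqP ->; rewrite ?porbit_step porbit_id.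
Qed.

(* Such [s] and [t] differ only in the choice of a perfect matching of the
   vertices that they transpose. *)
Lemma even_difference_odd_perm s t :
  (forall k, odd (perm_monomial s k) = odd (perm_monomial t k)) ->
  odd_perm s = odd_perm t.
Proof.
move=> st; apply: eq_odd_perm => i.
have edge s' t' j : (forall k, odd (perm_monomial s' k) = odd (perm_monomial t' k)) ->
    ~~ transposed s' j -> (t' j = s' j \/ t' (s' j) = j) /\ ~~ transposed t' j.
  move=> st'; rewrite -odd_perm_monomial_edge st' => odd_e.
  have : perm_monomial t' (symvar j (s' j)) != 0%N.
    by apply: contraTneq odd_e => ->.
  move=> /perm_monomial_symvar[tj|tj]; split; auto.
    by rewrite -odd_perm_monomial_edge tj.
  by rewrite -tj transposed_step -odd_perm_monomial_edge tj symvarC.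
have sub s' t' : (forall k, odd (perm_monomial s' k) = odd (perm_monomial t' k)) ->
    ~~ transposed s' i -> porbit s' i \subset porbit t' i.
  move=> st' ti; suff /fintype.subsetP h : porbit s' i \subset
      [set j in porbit t' i | ~~ transposed s' j]%SET.
    by apply/fintype.subsetP => j /h; rewrite inE => /andP[].
  apply: porbit_min => [|j]; rewrite !inE ?porbit_id// => /andP[ji tj].
  rewrite transposed_step tj andbT.
  have [[<-|h] _] := edge _ _ _ st' tj; first by rewrite porbit_step.
  by rewrite -porbit_step h.
have [ti|ti] := boolP (transposed s i); last first.
  have [_ ti'] := edge _ _ _ st ti.
  suff -> : porbit s i = porbit t i by [].
  by apply/eqP; rewrite finset.eqEsubset !sub.
rewrite !card_porbit_transposed//; apply: contraTT ti => ti.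
by have [] := edge t s i (fun k => esym (st k)) ti.
Qed.

Lemma lattice_length (F : set 'rV[R]_(symdim n)) l (f : nat -> 'rV[R]_(symdim n)) :
  {in [pred m : nat | (m <= l)%N] &, injective f} ->
  (forall x, (F `&` @lattice R _) x <-> exists m : nat, (m <= l)%N /\ x = f m) ->
  has_lattice_length F l.
Proof.
move=> f_inj Ff; rewrite /has_lattice_length.
have -> : F `&` @lattice R _ = f @` `I_l.+1.
  apply/seteqP; split=> x.
    by move=> /Ff[m [ml ->]]; exists m.
  by move=> [m ml <-]; apply/Ff; exists m.
apply: inj_card_eq => m m'; rewrite !inE => ml ml'; exact: f_inj.
Qed.

Lemma perm_point_lattice s : lattice (pt s).
Proof. by move=> k; rewrite mxE; exact/natr_int. Qed.

(** Exponents are at most 2, so they differ by at most 2. A difference of 1 forces the parameter [r]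
    to be an integer; if all differences are even, [2 * r] is one. *)
Lemma segment_lattice u v x : pt u != pt v ->
  segment (pt u) (pt v) x -> lattice x -> [\/ x = pt u, x = pt v |
    x = 2^-1 *: (pt u + pt v) /\
    forall k, odd (perm_monomial u k) = odd (perm_monomial v k)].
Proof.
move=> uv [r r01 xE] xl.
have int01 : r \is a Num.int -> r = 0 \/ r = 1.
  move=> /intrP[m rm]; have /andP[r0 r1] := r01; move: r0 r1.
  rewrite rm ler0z lerz1 => m0 m1.
  have [->|->] : m = 0 \/ m = 1 by lia.
    by left.
  by right.
have xk k : x 0 k = (perm_monomial u k)%:R +
    r * ((perm_monomial v k)%:R - (perm_monomial u k)%:R).
  by rewrite -xE !mxE; ring.
have r_ends : r = 0 \/ r = 1 -> [\/ x = pt u, x = pt v |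
    x = 2^-1 *: (pt u + pt v) /\
    forall k, odd (perm_monomial u k) = odd (perm_monomial v k)].
  case=> r_; [constructor 1|constructor 2]; rewrite -xE r_.
    by rewrite subr0 scale1r scale0r addr0.
  by rewrite subrr scale1r scale0r add0r.
have int_rd k : r * ((perm_monomial v k)%:R - (perm_monomial u k)%:R) \is a Num.int.
  have := xl k; rewrite xk; move: (r * _) => z zi.
  by rewrite -(addKr (perm_monomial u k)%:R z) rpredD// rpredN natr_int.
have lt2 (a b : nat) : (a <= 2)%N -> (b <= 2)%N -> odd a = odd b -> a != b ->
    b%:R - a%:R = 2 :> R \/ b%:R - a%:R = - 2 :> R.
  by move: a b => [|[|[|]]]// [|[|[|]]]// _ _ _ _; [left|right]; ring.
have lt1 (a b : nat) : (a <= 2)%N -> (b <= 2)%N -> odd a != odd b ->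
    b%:R - a%:R = 1 :> R \/ b%:R - a%:R = - 1 :> R.
  move: a b => [|[|[|]]]// [|[|[|]]]// _ _ _; by [left; ring|right; ring].
have [k0 uv0] : exists k, perm_monomial u k != perm_monomial v k.
  apply: contra_neqP uv => /forallNP h; apply/rowP => k; rewrite !mxE.
  by have := h k; case: eqP => [->|//].
have [/forallP all_even|] :=
    boolP [forall k, odd (perm_monomial u k) == odd (perm_monomial v k)].
  have even k : odd (perm_monomial u k) = odd (perm_monomial v k) by exact/eqP.
  have r2 : 2 * r \is a Num.int.
    have := int_rd k0.
    have [->|->] := lt2 _ _ (perm_monomial_le2 u k0) (perm_monomial_le2 v k0) (even k0) uv0.
      by rewrite mulrC.
    by rewrite mulrN rpredN mulrC.
  have /intrP[m rm] := r2; have /andP[r0 r1] := r01.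
  have m0 : 0 <= m by rewrite -(ler0z R) -rm mulr_ge0.
  have m2 : m <= 2 by rewrite -(ler_int R) -rm -[leRHS]mulr1 ler_pM2l.
  have [m_|[m_|m_]] : m = 0 \/ m = 2 \/ m = 1 by lia.
  - by apply: r_ends; left; move: rm; rewrite m_; lra.
  - by apply: r_ends; right; move: rm; rewrite m_; lra.
  - constructor 3; split=> //; have -> : 2^-1 = r by move: rm; rewrite m_; lra.
    rewrite -xE; apply/rowP => k; rewrite !mxE; have : r = 2^-1 by move: rm; rewrite m_; lra.
    by move=> ->; field.
move=> /forallPn[k uvk]; apply/r_ends/int01; have := int_rd k.
have [->|->] := lt1 _ _ (perm_monomial_le2 u k) (perm_monomial_le2 v k) uvk.
  by rewrite mulr1.
by rewrite mulrN1 rpredN.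
Qed.

End LatticePoints.

Section Edges.
Variables (R : realType) (n : nat).
Implicit Types (s t u v : 'S_n) (w x y : 'rV[R]_(symdim n)).
Local Notation pt := (perm_point R).
Local Notation P := (symdet_polytope R n).

Lemma segment_sym x y z : segment x y z -> segment y x z.
Proof.
move=> [r /andP[r0 r1] <-]; exists (1 - r).
  by apply/andP; split; lra.
by apply/rowP => k; rewrite !mxE; ring.
Qed.

Lemma segment_extreme (a b : 'rV[R]_(symdim n)) x y : segment a b x ->
  segment a b y -> x + y = a + a -> x = a.
Proof.
move=> [p /andP[p0 _] <-] [r /andP[r0 _] <-] e; apply/rowP => k.
have : (p + r) * (b 0 k - a 0 k) = 0.
  have := congr1 (fun z : 'rV_ _ => z 0 k) e; rewrite !mxE => ek.
  transitivity ((1 - p) * a 0 k + p * b 0 k + ((1 - r) * a 0 k + r * b 0 k) -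
    (a 0 k + a 0 k)); first by ring.
  by rewrite ek subrr.
move=> /eqP; rewrite mulf_eq0 paddr_eq0// subr_eq0 => /orP[/andP[/eqP -> _]|/eqP ba].
  by rewrite !mxE; ring.
by rewrite !mxE ba; ring.
Qed.

Section Edge.
Variables (u v : 'S_n) (w : 'rV[R]_(symdim n)).
Hypotheses (uv : pt u != pt v) (wE : face P w = segment (pt u) (pt v)).

Lemma face_minimizes s : minimizes w s <-> segment (pt u) (pt v) (pt s).
Proof.
rewrite -wE; split=> [ws|[_ ws] t]; last by apply: ws; exact: polytope_perm.
by split; [exact: polytope_perm|move=> y; exact: minimizes_polytope].
Qed.

(** Splitting a long even cycle would make an end of the edge the midpoint of two other points of
    the edge. *)
Lemma edge_end_vertex s : pt s = pt u \/ pt s = pt v ->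
  long_even_cycles s = finset.set0.
Proof.
move=> sE; have [//|[c /(perm_point_split R)[s1 [s2 [s12 s1s _ _ _]]]]] :=
  set_0Vmem (long_even_cycles s).
have ws : minimizes w s.
  by apply/face_minimizes; case: sE => ->; [exact: segment_l|exact: segment_r].
have [/face_minimizes w1 /face_minimizes w2] := minimizes_avg ws s12.
case/eqP: s1s; move: s12; case: sE => -> s12.
  exact: segment_extreme w1 w2 s12.
by apply: segment_extreme s12; apply: segment_sym; [exact: w1|exact: w2].
Qed.

(** An odd difference of exponents leaves only the two ends as lattice points, which then carry both
    signs. Otherwise [u] and [v] have equal signs, so the opposite sign sits at the midpoint. *)
Lemma mixed_edge_cases : mixed_face w ->
  (has_lattice_length (segment (pt u) (pt v)) 1 /\ odd_perm u != odd_perm v)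
  \/
  (has_lattice_length (segment (pt u) (pt v)) 2 /\
   exists s, pt s = 2^-1 *: (pt u + pt v) /\
     exists c : {set 'I_n}, long_even_cycles s = [set c]%SET /\ (4 %| #|c|)%N).
Proof.
move=> [s [t [/face_minimizes sE /face_minimizes tE so to]]].
have same_odd (a b : 'S_n) : pt a = pt b -> odd_perm a = odd_perm b.
  by move=> /exponent_vector_inj/odd_perm_monomial.
pose mid : 'rV[R]_(symdim n) := 2^-1 *: (pt u + pt v).
have midE : mid + mid = pt u + pt v.
  by apply/rowP => k; rewrite !mxE; field.
have seg_mid : segment (pt u) (pt v) mid.
  exists 2^-1; first by apply/andP; split; lra.
  by apply/rowP => k; rewrite !mxE; field.
have mid_u : mid != pt u.
  apply: contra_neq uv => mu; apply: (addrI (pt u)).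
  by rewrite -midE mu.
have mid_v : mid != pt v.
  by apply: contra_neq uv => mv; apply: (addIr (pt v)); rewrite -midE mv.
have [/forallP evenb|odd_diff] :=
    boolP [forall k, odd (perm_monomial u k) == odd (perm_monomial v k)]; last first.
  have ends a : segment (pt u) (pt v) (pt a) -> pt a = pt u \/ pt a = pt v.
    move=> aE; have [->|->|[_ h]] := segment_lattice uv aE (perm_point_lattice R a); auto.
    by case/negP: odd_diff; apply/forallP => k; apply/eqP/h.
  left; split; last first.
    case: (ends s sE) (ends t tE) so to => /same_odd -> [] /same_odd ->.
    - by move=> /negP.
    - by case: (odd_perm u); case: (odd_perm v).
    - by case: (odd_perm u); case: (odd_perm v).
    - by move=> /negP.
  apply: (@lattice_length _ _ _ _ (fun m => if m is 0%N then pt u else pt v)).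
    move=> [|[|m]] [|[|m']]// _ _ /eqP; first by rewrite (negPf uv).
    by rewrite eq_sym (negPf uv).
  move=> x; split=> [[xE xl]|[[|[|m]] [//_ ->]]]; last first.
  - by split; [exact: segment_r|exact: perm_point_lattice].
  - by split; [exact: segment_l|exact: perm_point_lattice].
  have [->|->|[_ h]] := segment_lattice uv xE xl; [by exists 0%N|by exists 1%N|].
  by case/negP: odd_diff; apply/forallP => k; apply/eqP/h.
have even k : odd (perm_monomial u k) = odd (perm_monomial v k) by exact/eqP.
have ouv := even_difference_odd_perm even.
right; split.
  apply: (@lattice_length _ _ _ _
    (fun m => if m is 0%N then pt u else if m is 1%N then mid else pt v)).
    move=> [|[|[|m]]] [|[|[|m']]]// _ _ /eqP; rewrite ?[pt u == _]eq_sym ?[pt v == mid]eq_sym;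
      by rewrite ?(negPf mid_u) ?(negPf mid_v) ?[pt v == pt u]eq_sym ?(negPf uv).
  move=> x; split=> [[xE xl]|[[|[|[|m]]] [//_ ->]]].
  - by have [->|->|[-> _]] := segment_lattice uv xE xl; [exists 0%N|exists 2%N|exists 1%N].
  - by split; [exact: segment_l|exact: perm_point_lattice].
  - split=> // k; rewrite !mxE -natrD -[X in _ * X%:R]odd_double_half oddD even addbb.
    by rewrite add0n -mul2n natrM mulKf// natr_int.
  - by split; [exact: segment_r|exact: perm_point_lattice].
have points a : segment (pt u) (pt v) (pt a) ->
    pt a = mid \/ ((pt a = pt u \/ pt a = pt v) /\ odd_perm a = odd_perm u).
  move=> aE; have [au|av|[am _]] := segment_lattice uv aE (perm_point_lattice R a).
  - by right; split; [left|exact: same_odd].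
  - by right; split; [right|rewrite ouv; exact: same_odd].
  - by left.
have [m [m_mid om]] : exists m, pt m = mid /\ odd_perm m != odd_perm u.
  have [sm|[_ sou]] := points s sE; last first.
    have [tm|[_ tou]] := points t tE; last by move: so; rewrite sou -tou to.
    by exists t; split=> //; rewrite -sou (negPf so) to.
  exists s; split=> //; rewrite (negPf so).
  have [tm|[_ <-]] := points t tE; last by rewrite to.
  by move: so; rewrite (same_odd s t) ?to// sm tm.
exists m; split=> //.
have mm : pt u + pt v = pt m + pt m by rewrite m_mid midE.
(* Without a long even cycle [m] would be a vertex, yet it is the midpoint of [u] and [v]. *)
have [l0|[c cm]] := set_0Vmem (long_even_cycles m).
  have [umin _] := minimizes_avg (off_support_min R m) mm.
  case/eqP: mid_u; rewrite -m_mid; apply/esym/(off_support_vertex l0).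
  by rewrite (minimizes_dot umin (off_support_min R m)) off_support_self.
have [s1 [s2 [s12 s1m l1 _ [sg1 _]]]] := perm_point_split R cm.
have wm : minimizes w m by apply/face_minimizes; rewrite m_mid.
have [w1 _] := minimizes_avg wm s12.
have [s1_mid|[s1_end os1]] := points s1 (proj1 (face_minimizes s1) w1).
  by case/eqP: s1m; rewrite s1_mid m_mid.
(* The splitting [s1] is an end of the edge. It has no long even cycle, so [c] is the only one of
   [m]; it has the sign of [u], so splitting [c] changes the sign and 4 divides its length. *)
exists c; split.
  have l0 := edge_end_vertex s1_end; apply/setP => d; have := finset.in_set0 d.
  rewrite -l0 l1 finset.in_setD1 finset.in_set1.
  by case: (eqVneq d c) => [->|_ /= ->].
by move: om; rewrite -os1 sg1; case: (4 %| _)%N => //; rewrite addbF eqxx.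
Qed.

End Edge.

End Edges.

Theorem theorem5p3 (R : realType) (n : nat) (n_gt0 : (0 < n)%N) :
  (forall u v : 'S_n,
     is_edge (symdet_polytope R n) (perm_point R u) (perm_point R v) ->
     let E := segment (perm_point R u) (perm_point R v) in
     (normal_cone (symdet_polytope R n) E
        `<=` trop_Cplus (singular_symmetric R n))
     <->
     ((has_lattice_length E 1 /\ odd_perm u != odd_perm v)
      \/
      (has_lattice_length E 2 /\
       exists s : 'S_n,
         perm_point R s = 2^-1 *: (perm_point R u + perm_point R v) /\
         exists c : {set 'I_n},
           long_even_cycles s = [set c]%SET /\ (4 %| #|c|)%N)))
  /\
  trop_Cplus (singular_symmetric R n) =
    \bigcup_(e in [set e : 'rV[R]_(symdim n) * 'rV[R]_(symdim n) |
                    is_edge (symdet_polytope R n) e.1 e.2 /\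
                    has_both_signs_monomial (segment e.1 e.2)])
      normal_cone (symdet_polytope R n) (segment e.1 e.2)
  /\
  (forall a b : 'rV[R]_(symdim n), is_edge (symdet_polytope R n) a b ->
     has_both_signs_monomial (segment a b) <->
     has_both_signs_perm (segment a b)).
Proof.
split; [|split] => [u v [uv [w wE]] E||a b _]; last exact: has_both_signsE.
  rewrite trop_mixedE; split=> [cone|cases z zE].
    (* The weight [w] that exposes the edge lies in its normal cone. *)
    apply: (mixed_edge_cases uv wE); apply: cone => x y.
    by rewrite /E -wE => -[_ xmin]; exact: xmin.
  have zu := normal_cone_minimizes zE (segment_l _ _).
  have zv := normal_cone_minimizes zE (segment_r _ _).
  case: cases => [[_]|[_ [s [s_mid [c [sc c4]]]]]]; first exact: mixed_faceP.
  have zs : minimizes z s.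
    apply: (normal_cone_minimizes zE); rewrite s_mid.
    exists 2^-1; first by apply/andP; split; lra.
    by apply/rowP => k; rewrite !mxE; field.
  have cs : c \in long_even_cycles s by rewrite sc finset.in_set1.
  (* Splitting the cycle of the midpoint changes the sign, so both signs occur among the minimizers
     of [z]. *)
  have [s1 [s2 [s12 _ _ _ [sg1 _]]]] := perm_point_split R cs.
  have [z1 _] := minimizes_avg zs s12.
  by apply: mixed_faceP z1 zs _; rewrite sg1 c4 addbT; case: odd_perm.
rewrite trop_mixedE; apply/seteqP; split=> [w /mixed_face_edge[a [b [eab wa wb sab]]]|w].
  exists (perm_point R a, perm_point R b); last exact: minimizes_normal_cone.
  by split=> //; exact/has_both_signsE.
move=> [[a b] /= [_ /has_both_signsE[s [t [sE tE so to]]]] wE].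
by exists s, t; split=> //;
  [exact: normal_cone_minimizes wE sE|exact: normal_cone_minimizes wE tE].
Qed.
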